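(* Let $\gamma>-1$ and let $\psi:\mathbb{D}\to\mathbb{D}$ be a holomorphic self-map of $\mathbb{D}$ that is not the identity map. Then the composition operator $C_\psi$ on $A^2_\gamma(\mathbb{D})$ satisfies $0\in\overline{\mathbf{Ber}(C_\psi)}\setminus\mathbf{Ber}(C_\psi)$.
   Context: $\mathbb{D}$ is the open unit disk of $\mathbb{C}$; $dA$ is area measure on $\mathbb{D}$ normalized so that $\mathbb{D}$ has area $1$; $dA_\gamma(w)=(\gamma+1)(1-|w|^2)^\gamma dA(w)$. The weighted Bergman space $A^2_\gamma(\mathbb{D})$ is the Hilbert space of holomorphic functions $f$ on $\mathbb{D}$ with $\int_{\mathbb{D}}|f|^2dA_\gamma<\infty$, with inner product $\langle f,g\rangle=\int_{\mathbb{D}}f\bar g\,dA_\gamma$. Its normalized reproducing kernel at $\xi\in\mathbb{D}$ is $\hat k^\gamma_\xi(w)=\frac{(1-|\xi|^2)^{(\gamma+2)/2}}{(1-\bar\xi w)^{\gamma+2}}$ (principal branch of the power). For a holomorphic self-map $\psi$ of $\mathbb{D}$, the composition operator is $C_\psi f=f\circ\psi$. For a bounded linear operator $T$ on $A^2_\gamma(\mathbb{D})$, the Berezin transform is $\widetilde T(\xi)=\langle T\hat k^\gamma_\xi,\hat k^\gamma_\xi\rangle$, $\xi\in\mathbb{D}$, and the Berezin range is $\mathbf{Ber}(T)=\{\widetilde T(\xi):\xi\in\mathbb{D}\}$. The overline denotes closure in $\mathbb{C}$. *)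

(* Defs.v *)
From HB Require Import structures.
From mathcomp Require Import all_boot all_order all_algebra.
From mathcomp Require Import complex.
From mathcomp Require Import all_classical all_reals all_analysis.

Set Implicit Arguments.
Unset Strict Implicit.
Unset Printing Implicit Defensive.

Import Order.TTheory GRing.Theory Num.Theory.
Import numFieldNormedType.Exports.

Local Open Scope classical_set_scope.
Local Open Scope ring_scope.
Local Open Scope complex_scope.

(* The complex plane: R[i] as a normed space over itself: [derivable] on this type is complex
   differentiability, and its topology is the usual one of the plane. *)
Notation Cplane R := (R[i]^o).

Section Defs.
Variable R : realType.
Local Notation C := (Cplane R).

(* The modulus as an element of R; the library norm [`|z|] is its image in R[i]. *)
Definition cabs (z : C) : R := Normc.normc z.

Definition disk : set C := [set z | cabs z < 1].

Definition holomorphic_on_disk (f : C -> C) : Prop :=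
  forall z, disk z -> derivable f z 1.

(* Principal argument, in ]-pi, pi] for z <> 0. *)
Definition carg (z : C) : R :=
  if 0 <= complex.Im z then acos (complex.Re z / cabs z)
  else - acos (complex.Re z / cabs z).

(* Principal branch of z^s for a real exponent s and z <> 0. *)
Definition cpow (z : C) (s : R) : C :=
  (cabs z `^ s)%:C * (cos (s * carg z) +i* sin (s * carg z)).

Local Notation leb2 := (@lebesgue_measure R \x @lebesgue_measure R)%E.

(* Lebesgue measure lives on R * R; the point (x, y) stands for x + iy. *)
Definition pt (p : R * R) : C := p.1 +i* p.2.

Definition disk2 : set (R * R) := [set p | disk (pt p)].

(* Area measure dA: Lebesgue measure on the disk divided by the area of the disk. *)
Definition int_dA (F : C -> \bar R) : \bar R :=
  ((fine (leb2 disk2))^-1%:E *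
   \int[leb2]_(p in disk2) F (pt p))%E.

Definition weight (gamma : R) (w : C) : R :=
  (gamma + 1) * (1 - cabs w ^+ 2) `^ gamma.

Definition int_dAg (gamma : R) (F : C -> R) : \bar R :=
  int_dA (fun w => (F w * weight gamma w)%:E).

Definition cint_dAg (gamma : R) (F : C -> C) : C :=
  fine (int_dAg gamma (fun w => complex.Re (F w))) +i*
  fine (int_dAg gamma (fun w => complex.Im (F w))).

(* A function C -> C represents its restriction to the disk. *)
Definition bergman (gamma : R) : set (C -> C) :=
  [set f | holomorphic_on_disk f /\
           (int_dAg gamma (fun w => (cabs (f w) ^+ 2)%R) < +oo)%E].

Definition bergman_inner (gamma : R) (f g : C -> C) : C :=
  cint_dAg gamma (fun w => f w * (g w)^*).

Definition nkernel (gamma : R) (xi w : C) : C :=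
  ((1 - cabs xi ^+ 2) `^ ((gamma + 2) / 2))%:C / cpow (1 - xi^* * w) (gamma + 2).

(* An operator on the Bergman space is represented by a map on functions
   C -> C, of which only the action on [bergman gamma] matters. *)
Definition berezin (gamma : R) (T : (C -> C) -> (C -> C)) (xi : C) : C :=
  bergman_inner gamma (T (nkernel gamma xi)) (nkernel gamma xi).

Definition Ber (gamma : R) (T : (C -> C) -> (C -> C)) : set C :=
  [set berezin gamma T xi | xi in disk].

(* T acts on the Bergman space as the composition operator of symbol psi.  This
   determines T f on the disk for every f in the Bergman space, hence [Ber]. *)
Definition is_composition_operator (gamma : R) (psi : C -> C)
    (T : (C -> C) -> (C -> C)) : Prop :=
  forall f, bergman gamma f -> forall z, disk z -> T f z = f (psi z).

End Defs.

(* Main.v *)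
(* By the reproducing property the Berezin transform of C_psi at xi is
   ((1 - |xi|^2) / (1 - conj(xi) psi(xi)))^(gamma+2), which never vanishes. If it stayed
   away from 0, then |1 - conj(xi) psi(xi)| = O(1 - |xi|^2), so psi(xi) - xi would tend to 0
   at the boundary and vanish identically by the maximum principle.

   Both ingredients come from Green's formula: with s = 1 - |w|^2 and p = gamma + 1,
     dbar [ (s / (1 - xi conj(w)))^p ] = p (xi - w) s^(p-1) / (1 - xi conj(w))^(p+1),
   so the integral of (f - f(xi)) against the conjugate kernel is, up to a constant, that of
   dbar (q (s / (1 - xi conj(w)))^p) with q = (f - f(xi)) / (w - xi), a function that
   vanishes on the circle. As holomorphy is only pointwise differentiability, Green's
   formula is proved by Goursat's bisection argument. The maximum principle is Harnack's
   inequality, i.e. the reproducing formula for M - f times the kernel. The mass of the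
   weight cancels everywhere, so polar coordinates are never needed. *)

(* Only bounded holomorphic functions occur: for [|xi| < 1] the kernel is bounded, and so is its
   composition with [psi]; the reproducing formula is proved for this class. Two obstacles shape its
   proof. First, holomorphy of [q] at [xi] itself would be a removable singularity theorem, part of
   the very theory that is being built, so Green's formula is stated for functions that may be
   merely continuous at one point. Second, for [p < 1] the function [s^p] is not differentiable up
   to the circle and [s^(p-1)] is unbounded, so Green's formula is first applied to truncations that
   vanish near the circle. Applied to [conj(w)] times a truncation, it also bounds the integral of
   [|w|^2] times the derivative of the truncation, uniformly; Fatou's lemma turns this into
   integrability of [s^(p-1)], which then dominates the passage to the limit in general. The
   boundary behaviour of [psi] comes from [psi(z) - z = s psi(z) - z (1 - conj(z) psi(z))], where
   both terms are [O(s)]. *)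
Require Import Defs.
From HB Require Import structures.
From mathcomp Require Import all_boot all_order all_algebra.
From mathcomp Require Import complex.
From mathcomp Require Import all_classical all_reals all_analysis.
From mathcomp Require Import measurable_realfun ring lra.

Import Order.TTheory GRing.Theory Num.Theory.
Import numFieldNormedType.Exports.

Set Implicit Arguments.
Unset Strict Implicit.
Unset Printing Implicit Defensive.

Local Open Scope classical_set_scope.
Local Open Scope ring_scope.
Local Open Scope complex_scope.

(** * Complex numbers and Wirtinger derivatives *)

(* Re, Im, conjugation and the embedding of R with source or target the normed space R[i]^o:
   without them, elaboration mixes the ring structures of R[i] and R[i]^o. *)
Definition cre (R : realType) (z : Cplane R) : R := complex.Re z.
Definition cim (R : realType) (z : Cplane R) : R := complex.Im z.
Definition cconj (R : realType) (z : Cplane R) : Cplane R := z^*.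
Definition creal (R : realType) (x : R) : Cplane R := x%:C.

Section ComplexModulus.
Variable R : realType.
Local Notation C := (Cplane R).
Implicit Types (z w : C) (x y : R).

Lemma normcE z : `|z| = (cabs z)%:C :> R[i].
Proof. by rewrite normc_def /cabs; case: z. Qed.

Lemma cabsM z w : cabs (z * w) = cabs z * cabs w.
Proof. exact: Normc.normcM. Qed.

Lemma cabsV z : cabs z^-1 = (cabs z)^-1.
Proof. exact: Normc.normcV. Qed.

Lemma cabsN z : cabs (- z) = cabs z.
Proof. exact: normcN. Qed.

Lemma cabsD z w : cabs (z + w) <= cabs z + cabs w.
Proof. exact: le_normcD. Qed.

Lemma cabsBC z w : cabs (z - w) = cabs (w - z).
Proof. by rewrite -cabsN opprB. Qed.

Lemma cabs0 : cabs (0 : C) = 0.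
Proof. exact: Normc.normc0. Qed.

Lemma cabs1 : cabs (1 : C) = 1.
Proof. exact: Normc.normc1. Qed.

Lemma cabs_ge0 z : 0 <= cabs z.
Proof. by case: z => a b; rewrite /cabs /= sqrtr_ge0. Qed.

Lemma cabs_sqr z : cabs z ^+ 2 = cre z ^+ 2 + cim z ^+ 2.
Proof.
by case: z => a b; rewrite /cabs /cre /cim /= sqr_sqrtr // addr_ge0 // sqr_ge0.
Qed.

Lemma cabs_eq0 z : (cabs z == 0) = (z == 0).
Proof.
apply/eqP/eqP => [|->]; last exact: cabs0.
exact: Normc.eq0_normc.
Qed.

Lemma cabs_gt0 z : (0 < cabs z) = (z != 0).
Proof. by rewrite lt_def cabs_eq0 cabs_ge0 andbT. Qed.

Lemma cabsJ z : cabs (cconj z) = cabs z.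
Proof. by case: z => a b; rewrite /cabs /= sqrrN. Qed.

Lemma cabsR x : cabs (creal x) = `|x|.
Proof. by rewrite /cabs /= expr0n /= addr0 sqrtr_sqr. Qed.

Lemma ler_cre_cabs z : `|cre z| <= cabs z.
Proof.
rewrite -(ler_pXn2r (n := 2)) ?nnegrE ?cabs_ge0 ?normr_ge0 //.
by rewrite cabs_sqr real_normK ?num_real // lerDl sqr_ge0.
Qed.

Lemma ler_cim_cabs z : `|cim z| <= cabs z.
Proof.
rewrite -(ler_pXn2r (n := 2)) ?nnegrE ?cabs_ge0 ?normr_ge0 //.
by rewrite cabs_sqr real_normK ?num_real // lerDr sqr_ge0.
Qed.

Lemma cabs_le z : cabs z <= `|cre z| + `|cim z|.
Proof.
rewrite -(ler_pXn2r (n := 2)) ?nnegrE ?cabs_ge0 ?addr_ge0 //.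
rewrite cabs_sqr sqrrD !real_normK ?num_real // addrAC lerDl.
by rewrite mulrn_wge0 // mulr_ge0.
Qed.

Lemma complexP z w : cre z = cre w -> cim z = cim w -> z = w.
Proof. by case: z w => a b [c d]; rewrite /cre /cim /= => -> ->. Qed.

Lemma creM z w : cre (z * w) = cre z * cre w - cim z * cim w.
Proof. by case: z; case: w. Qed.

Lemma cimM z w : cim (z * w) = cre z * cim w + cim z * cre w.
Proof. by case: z; case: w. Qed.

Lemma creD z w : cre (z + w) = cre z + cre w.
Proof. by case: z; case: w. Qed.

Lemma cimD z w : cim (z + w) = cim z + cim w.
Proof. by case: z; case: w. Qed.

Lemma creN z : cre (- z) = - cre z.
Proof. by case: z. Qed.

Lemma cimN z : cim (- z) = - cim z.
Proof. by case: z. Qed.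

Lemma creJ z : cre (cconj z) = cre z.
Proof. by case: z. Qed.

Lemma cimJ z : cim (cconj z) = - cim z.
Proof. by case: z. Qed.

Lemma creR x : cre (creal x) = x. Proof. by []. Qed.

Lemma cimR x : cim (creal x) = 0. Proof. by []. Qed.

Lemma cconjM z w : cconj (z * w) = cconj z * cconj w.
Proof. exact: rmorphM. Qed.

Lemma cconjD z w : cconj (z + w) = cconj z + cconj w.
Proof. exact: rmorphD. Qed.

Lemma cconjN z : cconj (- z) = - cconj z.
Proof. exact: rmorphN. Qed.

Lemma cconjK z : cconj (cconj z) = z.
Proof. exact: conjcK. Qed.

Lemma cconj0 : cconj (0 : C) = 0.
Proof. exact: conjc0. Qed.

Lemma cconj1 : cconj (1 : C) = 1.
Proof. exact: conjc1. Qed.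

Lemma cconjR x : cconj (creal x) = creal x.
Proof. exact: conjc_real. Qed.

Lemma crealD x y : creal (x + y) = creal x + creal y.
Proof. exact: rmorphD. Qed.

Lemma crealN x : creal (- x) = - creal x.
Proof. exact: rmorphN. Qed.

Lemma crealM x y : creal (x * y) = creal x * creal y.
Proof. exact: rmorphM. Qed.

Lemma crealV x : creal x^-1 = (creal x)^-1.
Proof. exact: fmorphV. Qed.

Lemma creal0 : creal 0 = 0 :> C. Proof. by []. Qed.

Lemma creal1 : creal 1 = 1 :> C. Proof. by []. Qed.

Lemma creal_eq0 x : (creal x == 0) = (x == 0).
Proof. by rewrite -cabs_eq0 cabsR normr_eq0. Qed.

Lemma mulzJ z : z * cconj z = creal (cabs z ^+ 2).
Proof.
rewrite cabs_sqr; apply: complexP.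
  by rewrite creM creJ cimJ creR; ring.
by rewrite cimM creJ cimJ cimR; ring.
Qed.

Lemma creE z : creal (cre z) = (z + cconj z) / creal 2.
Proof.
rewrite -crealV; apply: complexP.
  by rewrite creM creD creJ !creR cimR; field.
by rewrite cimM creR cimR cimD cimJ cimR; field.
Qed.

End ComplexModulus.

(** * Continuity on the plane in epsilon-delta form *)

Section ComplexContinuity.
Variable R : realType.
Local Notation C := (Cplane R).

(** The norm of [R[i]^o] takes its values in [R[i]], so the radius of a ball is a complex number. A
    positive one has imaginary part 0, which brings everything back to radii in [R]. *)
Lemma nbhs_cabs (z : C) (P : set C) :
  nbhs z P <-> exists2 d : R, 0 < d & forall w, cabs (w - z) < d -> P w.
Proof.
split=> [/nbhs_ballP[e /= e0 Pe]|[d d0 Pd]].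
  have [e0' eE] : 0 < complex.Re e /\ e = (complex.Re e)%:C.
    by move: e0; rewrite ltcE /= => /andP[/eqP ie re]; split=> //; apply: complexP.
  exists (complex.Re e) => // w wz; apply: Pe.
  by rewrite -ball_normE /= normcE eE ltcR cabsBC.
apply/nbhs_ballP; exists (d%:C : R[i]) => /=; first by rewrite ltcR.
by move=> w; rewrite -ball_normE /= normcE ltcR cabsBC => /Pd.
Qed.

Lemma continuousCP (F : C -> C) (z : C) : {for z, continuous F} <->
  forall e : R, 0 < e ->
  exists2 d : R, 0 < d & forall w, cabs (w - z) < d -> cabs (F w - F z) < e.
Proof.
split=> [cF e e0|H P].
  have /cF/nbhs_cabs[d d0 Hd] : nbhs (F z) [set u | cabs (u - F z) < e].
    by apply/nbhs_cabs; exists e.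
  by exists d.
move=> /nbhs_cabs[e e0 Pe]; have [d d0 Hd] := H _ e0.
by apply/nbhs_cabs; exists d => // w /Hd /Pe.
Qed.

Lemma continuousRP (F : C -> R) (z : C) : {for z, continuous F} <->
  forall e : R, 0 < e ->
  exists2 d : R, 0 < d & forall w, cabs (w - z) < d -> `|F w - F z| < e.
Proof.
split=> [cF e e0|H P].
  have /cF/nbhs_cabs[d d0 Hd] : nbhs (F z) [set u | `|u - F z| < e].
    apply/nbhs_ballP; exists e => //= u; rewrite -ball_normE /= distrC.
    by [].
  by exists d.
move=> /nbhs_ballP[e /= e0 Pe]; have [d d0 Hd] := H _ e0.
apply/nbhs_cabs; exists d => // w /Hd h; apply: Pe.
by rewrite -ball_normE /= distrC.
Qed.

Lemma continuous_cconj (z : C) : {for z, continuous (@cconj R)}.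
Proof.
apply/continuousCP => e e0; exists e => // w.
by rewrite -cconjN -cconjD cabsJ.
Qed.

Lemma continuous_cre (z : C) : {for z, continuous (@cre R)}.
Proof.
apply/continuousRP => e e0; exists e => // w; apply: le_lt_trans.
by rewrite -creN -creD ler_cre_cabs.
Qed.

Lemma continuous_cim (z : C) : {for z, continuous (@cim R)}.
Proof.
apply/continuousRP => e e0; exists e => // w; apply: le_lt_trans.
by rewrite -cimN -cimD ler_cim_cabs.
Qed.

Lemma continuous_creal (F : C -> R) (z : C) :
  {for z, continuous F} -> {for z, continuous (fun w => creal (F w))}.
Proof.
move=> /continuousRP H; apply/continuousCP => e e0; have [d d0 Hd] := H _ e0.
by exists d => // w /Hd; rewrite -crealN -crealD cabsR.
Qed.

Lemma continuous_cst_C (c z : C) : {for z, continuous (fun _ : C => c)}.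
Proof. exact: cst_continuous. Qed.

Lemma continuous_id_C (z : C) : {for z, continuous (fun w : C => w)}.
Proof. by move=> P; apply. Qed.

Lemma continuousM_C (F G : C -> C) (z : C) : {for z, continuous F} ->
  {for z, continuous G} -> {for z, continuous (fun w => F w * G w)}.
Proof. move=> cF cG; exact: cvgM cF cG. Qed.

Lemma continuousD_C (F G : C -> C) (z : C) : {for z, continuous F} ->
  {for z, continuous G} -> {for z, continuous (fun w => F w + G w)}.
Proof. move=> cF cG; exact: cvgD cF cG. Qed.

Lemma continuousN_C (F : C -> C) (z : C) : {for z, continuous F} ->
  {for z, continuous (fun w => - F w)}.
Proof. move=> cF; exact: cvgN cF. Qed.

Lemma continuousV_C (F : C -> C) (z : C) : F z != 0 -> {for z, continuous F} ->
   {for z, continuous (fun w => (F w)^-1)}.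
Proof. move=> n0 cF; exact: (@cvgV R[i] _ _ _ F (F z) n0 cF). Qed.

Lemma continuousJ_C (F : C -> C) (z : C) : {for z, continuous F} ->
  {for z, continuous (fun w => cconj (F w))}.
Proof. by move=> cF; apply: (continuous_comp cF); exact: continuous_cconj. Qed.

Lemma near_continuous (F G : C -> C) (z : C) (d : R) : 0 < d ->
  (forall w, cabs (w - z) < d -> F w = G w) ->
  {for z, continuous F} -> {for z, continuous G}.
Proof.
move=> d0 FG /continuousCP H; apply/continuousCP => e e0.
have [d' d'0 H'] := H _ e0; exists (Num.min d d'); first by rewrite lt_min d0.
move=> w; rewrite lt_min => /andP[/FG <- /H'].
by rewrite -(FG z) // subrr cabs0.
Qed.

End ComplexContinuity.

(** * Calculus of Wirtinger derivatives *)

Section RealDifferentiability.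
Variable R : realType.
Local Notation C := (Cplane R).
Implicit Types (F G : C -> C) (z w A B : C).

(* Caratheodory form of real differentiability: A and B are the Wirtinger derivatives
   of F at z with respect to w and to its conjugate. *)
Definition rdiff F z A B : Prop := exists a b : C -> C,
  [/\ forall w, F w - F z = a w * (w - z) + b w * cconj (w - z),
      {for z, continuous a}, {for z, continuous b}, a z = A & b z = B].

(** Away from [z] the expansion can be forced, with the difference quotient as first slope and 0 as
    second, so slopes given on a ball extend to the plane without changing their germs at [z]. *)
Lemma rdiff_local F z (d : R) (a b : C -> C) : 0 < d ->
  (forall w, cabs (w - z) < d -> F w - F z = a w * (w - z) + b w * cconj (w - z)) ->
  {for z, continuous a} -> {for z, continuous b} -> rdiff F z (a z) (b z).
Proof.
move=> d0 H ca cb.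
pose a' w := if cabs (w - z) < d then a w else (F w - F z) / (w - z).
pose b' w := if cabs (w - z) < d then b w else 0.
have zd : cabs (z - z) < d by rewrite subrr cabs0.
exists a', b'; split.
- move=> w; rewrite /a' /b'; case: ifPn => [/H//|wd].
  rewrite mul0r addr0 divfK // subr_eq0; apply: contraNneq wd => ->.
  by rewrite subrr cabs0.
- by apply: (near_continuous d0 _ ca) => w wd; rewrite /a' wd.
- by apply: (near_continuous d0 _ cb) => w wd; rewrite /b' wd.
- by rewrite /a' zd.
- by rewrite /b' zd.
Qed.

Lemma near_rdiff F G z A B (d : R) : 0 < d ->
  (forall w, cabs (w - z) < d -> F w = G w) -> rdiff F z A B -> rdiff G z A B.
Proof.
move=> d0 FG [a [b [H ca cb <- <-]]]; apply: (rdiff_local d0 _ ca cb) => w wd.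
by rewrite -FG // -FG ?H // subrr cabs0.
Qed.

Lemma rdiff_cst (c z : C) : rdiff (fun=> c) z 0 0.
Proof.
exists (fun=> 0), (fun=> 0); split; try exact: continuous_cst_C; try by [].
by move=> w; rewrite subrr !mul0r addr0.
Qed.

Lemma rdiff_id z : rdiff id z 1 0.
Proof.
exists (fun=> 1), (fun=> 0); split; try exact: continuous_cst_C; try by [].
by move=> w; rewrite mul1r mul0r addr0.
Qed.

Lemma rdiff_conj z : rdiff (@cconj R) z 0 1.
Proof.
exists (fun=> 0), (fun=> 1); split; try exact: continuous_cst_C; try by [].
by move=> w; rewrite mul1r mul0r add0r cconjD cconjN.
Qed.

Lemma rdiff_continuous F z A B : rdiff F z A B -> {for z, continuous F}.
Proof.
move=> [a [b [H ca cb _ _]]].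
have cB : {for z, continuous (fun w => w - z : C)}.
  by apply: continuousD_C; [exact: continuous_id_C|exact: continuous_cst_C].
apply: (near_continuous (F := fun w => (a w * (w - z) + b w * cconj (w - z)) + F z) ltr01).
  by move=> w _; rewrite -H subrK.
apply: continuousD_C; last exact: continuous_cst_C.
exact: continuousD_C (continuousM_C ca cB) (continuousM_C cb (continuousJ_C cB)).
Qed.

Lemma rdiffD F G z A B A' B' : rdiff F z A B -> rdiff G z A' B' ->
  rdiff (fun w => F w + G w) z (A + A') (B + B').
Proof.
move=> [a [b [H ca cb <- <-]]] [a' [b' [H' ca' cb' <- <-]]].
exists (fun w => a w + a' w), (fun w => b w + b' w).
split.
- by move=> w; rewrite opprD addrACA H H'; ring.
- exact: continuousD_C ca ca'.
- exact: continuousD_C cb cb'.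
- by [].
- by [].
Qed.

Lemma rdiffM F G z A B A' B' : rdiff F z A B -> rdiff G z A' B' ->
  rdiff (fun w => F w * G w) z (A * G z + F z * A') (B * G z + F z * B').
Proof.
move=> dF [a' [b' [H' ca' cb' <- <-]]].
have cF := rdiff_continuous dF; case: dF => [a [b [H ca cb <- <-]]].
exists (fun w => a w * G z + F w * a' w), (fun w => b w * G z + F w * b' w).
have cGz := @continuous_cst_C _ (G z) z.
split.
- move=> w; have -> : F w * G w - F z * G z =
    (F w - F z) * G z + F w * (G w - G z) by ring.
  by rewrite H H'; ring.
- exact: continuousD_C (continuousM_C ca cGz) (continuousM_C cF ca').
- exact: continuousD_C (continuousM_C cb cGz) (continuousM_C cF cb').
- by [].
- by [].
Qed.

Lemma rdiff_comp F G z A B A' B' : rdiff G z A B -> rdiff F (G z) A' B' ->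
  rdiff (fun w => F (G w)) z (A' * A + B' * cconj B) (A' * B + B' * cconj A).
Proof.
move=> dG [a' [b' [H' ca' cb' <- <-]]].
have cG := rdiff_continuous dG; case: dG => [a [b [H ca cb <- <-]]].
have ca'' : {for z, continuous (fun w => a' (G w))} by exact: (continuous_comp cG ca').
have cb'' : {for z, continuous (fun w => b' (G w))} by exact: (continuous_comp cG cb').
exists (fun w => a' (G w) * a w + b' (G w) * cconj (b w)),
  (fun w => a' (G w) * b w + b' (G w) * cconj (a w)).
split.
- move=> w; rewrite H' H; move: (w - z) => u; rewrite cconjD !cconjM cconjK; ring.
- exact: continuousD_C (continuousM_C ca'' ca) (continuousM_C cb'' (continuousJ_C cb)).
- exact: continuousD_C (continuousM_C ca'' cb) (continuousM_C cb'' (continuousJ_C ca)).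
- by [].
- by [].
Qed.

Lemma rdiffJ F z A B : rdiff F z A B -> rdiff (fun w => cconj (F w)) z (cconj B) (cconj A).
Proof.
move=> dF; have := rdiff_comp dF (rdiff_conj (F z)).
by rewrite !mul0r !mul1r !add0r.
Qed.

Lemma rdiffV F z A B : F z != 0 -> rdiff F z A B ->
  rdiff (fun w => (F w)^-1) z (- A / F z ^+ 2) (- B / F z ^+ 2).
Proof.
move=> n0 dF.
(* The exact identity [1/w - 1/u = - (w - u) / (w u)] with [u = F z] gives the slope; the ball of
   radius [|u|] keeps [w] away from 0. *)
have dV : rdiff (fun w : C => w^-1 : C) (F z) (- (F z ^+ 2)^-1) 0.
  have := @rdiff_local (fun w : C => w^-1 : C) (F z) (cabs (F z))
    (fun w => - (w^-1 * (F z)^-1)) (fun=> 0).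
  rewrite -invfM -expr2; apply.
  - by rewrite cabs_gt0.
  - move=> w wd; have w0 : w != 0.
      by apply: contraTneq wd => ->; rewrite sub0r cabsN ltxx.
    by rewrite mul0r addr0; field; rewrite n0 w0.
  - apply: continuousN_C; apply: continuousM_C; last exact: continuous_cst_C.
    exact: continuousV_C n0 (@continuous_id_C _ _).
  - exact: continuous_cst_C.
have := rdiff_comp dF dV.
by rewrite !mul0r !addr0 ![- (F z ^+ 2)^-1 * _]mulrC !mulrN !mulNr.
Qed.

(** The increment of [cre] is half the sum of [w - z] and its conjugate, so the real slope is shared
    equally between both Wirtinger derivatives. *)
Lemma rdiff_real (f : R -> R) (z : C) (f' : R) : is_derive (cre z) (1 : R) f f' ->
  rdiff (fun w => creal (f (cre w))) z (creal (f' / 2)) (creal (f' / 2)).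
Proof.
move=> /is_derive1_caratheodory[g [H cg <-]].
have cG : {for z, continuous (fun w : C => creal (g (cre w) / 2))}.
  apply: continuous_creal.
  apply: (@continuous_comp _ _ _ (@cre R) (fun x => g x / 2)).
    exact: continuous_cre.
  by apply: cvgM cg _; exact: cvg_cst.
exists (fun w => creal (g (cre w) / 2)), (fun w => creal (g (cre w) / 2)).
split; [move=> w|exact: cG|exact: cG|by []|by []].
have := creE (w - z); rewrite creD creN => E.
rewrite -mulrDr -crealN -crealD H !crealM E crealV.
have n2 : creal (2 : R) != 0 by rewrite creal_eq0 pnatr_eq0.
by move: (creal 2) n2 => t n2; field.
Qed.

(** Bridge to the complex differentiability of the statement. From right to left, the conjugate term
    contributes [b (h + z)] times a quotient of modulus 1 to the difference quotient, and [b] tends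
    to [b z = 0]. *)
Lemma derivable_rdiff (f : C -> C) z : derivable f z 1 <-> exists A, rdiff f z A 0.
Proof.
split=> [df|[A [a [b [H ca cb az bz]]]]].
  have [l Hl] := (cvg_ex _).1 df; exists l.
  pose a w := if w == z then l else (f w - f z) / (w - z).
  exists a, (fun=> 0); split; last by [].
  - move=> w; rewrite mul0r addr0 /a; case: eqVneq => [->|wz].
      by rewrite !subrr mulr0.
    by rewrite divfK // subr_eq0.
  - apply/continuousCP => e e0.
    have /Hl : nbhs l [set u : C | cabs (u - l) < e] by apply/nbhs_cabs; exists e.
    move=> /nbhs_cabs[d d0 Hd]; exists d => // w wd.
    rewrite /a eqxx; case: eqVneq => [_|wz]; first by rewrite subrr cabs0.
    have := Hd (w - z); rewrite subr0 subr_eq0 => /(_ wd wz) /=.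
    by rewrite /shift /= -[_ *: 1]/((w - z) * 1) mulr1 subrK -[_ *: _]/((w - z)^-1 * _) mulrC.
  - exact: continuous_cst_C.
  - by rewrite /a eqxx.
apply/cvg_ex; exists A => P /nbhs_cabs[e e0 Pe].
have e20 : 0 < e / 2 by rewrite divr_gt0.
have /continuousCP/(_ _ e20)[d1 d10 H1] := ca.
have /continuousCP/(_ _ e20)[d2 d20 H2] := cb.
apply/nbhs_cabs; exists (Num.min d1 d2); first by rewrite lt_min d10.
move=> h; rewrite subr0 lt_min => /andP[h1 h2] h0.
apply: Pe => /=; rewrite -[_ *: 1]/(h * 1) mulr1 -[_ *: _]/(h^-1 * _) H addrK.
have /H1 : cabs ((h + z) - z) < d1 by rewrite addrK.
have /H2 : cabs ((h + z) - z) < d2 by rewrite addrK.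
rewrite az bz subr0 => K2 K1.
have -> : h^-1 * (a (h + z) * h + b (h + z) * cconj h) - A =
  (a (h + z) - A) + b (h + z) * (cconj h / h) by field.
apply: le_lt_trans (cabsD _ _) _; rewrite [e]splitr; apply: ltrD => //.
by rewrite !cabsM cabsJ cabsV divff ?mulr1 // cabs_eq0.
Qed.

End RealDifferentiability.

(** * Green's formula without continuity of the derivatives *)

Section Bisection.
Variable R : realType.
Implicit Types (x y l p q e d : R).

Lemma exists_half_lt l d : 0 < l -> 0 < d -> exists n, l / 2 ^+ n < d.
Proof.
move=> l0 d0; exists (Num.truncn (l / d)).+1.
set n := (Num.truncn _).+1.
have h : l / d < n%:R by rewrite /n truncnS_gt // num_real.
rewrite ltr_pdivrMr ?exprn_gt0 // mulrC -ltr_pdivrMr //.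
apply: lt_le_trans h _; rewrite -natrX ler_nat.
by rewrite ltnW // ltn_expl.
Qed.

(** Goursat's argument: if [|E| > e m] on a square, then the same holds on one of its quarters, and
    the nested squares obtained this way shrink to a point where the local estimate fails. The point
    may lie on an edge of each square, hence the closed inequalities. The majorant [m] is left
    abstract because area alone will not do. *)
Lemma bisection (E m : R -> R -> R -> R) :
  (forall x y l, 0 < l -> `|E x y (l + l)| <=
    `|E x y l| + `|E (x + l) y l| + `|E x (y + l) l| + `|E (x + l) (y + l) l|) ->
  (forall x y l, 0 < l ->
    m x y l + m (x + l) y l + m x (y + l) l + m (x + l) (y + l) l <= m x y (l + l)) ->
  (forall p q e, 0 < e -> exists2 d, 0 < d & forall x y l, 0 < l -> l < d ->
    x <= p <= x + l -> y <= q <= y + l -> `|E x y l| <= e * m x y l) ->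
  forall x y l, 0 < l -> E x y l = 0.
Proof.
move=> subE superm locE x0 y0 l0 l0gt0.
suff H e : 0 < e -> `|E x0 y0 l0| <= e * m x0 y0 l0.
  apply/eqP/contraT; rewrite -normr_gt0 => Egt0.
  set M := `|m x0 y0 l0| + 1.
  have M0 : 0 < M by rewrite /M ltr_wpDl.
  have := H (`|E x0 y0 l0| / M / 2) _; rewrite !divr_gt0 // => /(_ isT).
  rewrite leNgt => /negP[].
  have mM : m x0 y0 l0 <= M by rewrite /M (le_trans (ler_norm _)) // lerDl.
  have e0 : 0 <= `|E x0 y0 l0| / M / 2 by rewrite !divr_ge0 // ltW.
  apply: le_lt_trans (ler_wpM2l e0 mM) _.
  rewrite mulrAC divfK ?gt_eqF // ltr_pdivrMr // mulr_natr mulr2n.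
  by rewrite ltrDl.
move=> e0; rewrite leNgt; apply/negP => E0.
pose l (n : nat) := l0 / 2 ^+ n.
have lgt0 n : 0 < l n by rewrite divr_gt0 // exprn_gt0.
have lS n : l n = l n.+1 + l n.+1.
  rewrite /l exprS; have : (2 ^+ n : R) != 0 by rewrite expf_neq0.
  by move=> h; field; rewrite h.
pose P n (s : R * R) := e * m s.1 s.2 (l n) < `|E s.1 s.2 (l n)|.
(* Stated as an implication under the existential, so that [choice] gives a total function; when [P]
   fails any corner serves. *)
have step (ns : nat * (R * R)) : exists s', P ns.1 ns.2 ->
    [/\ P ns.1.+1 s', ns.2.1 <= s'.1 <= ns.2.1 + l ns.1.+1 &
        ns.2.2 <= s'.2 <= ns.2.2 + l ns.1.+1].
  case: ns => n [x y] /=.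
  have [Pn|nP] := pselect (P n (x, y)); last by exists (x, y).
  apply: contrapT => /forallNP nex.
  have ln := ltW (lgt0 n.+1).
  have bad x' y' : x <= x' <= x + l n.+1 -> y <= y' <= y + l n.+1 ->
      `|E x' y' (l n.+1)| <= e * m x' y' (l n.+1).
    move=> hx hy; rewrite leNgt; apply/negP => h.
    by apply: (nex (x', y')) => _; split.
  move: Pn; rewrite /P /= lS ltNge => /negP; apply.
  apply: le_trans (subE _ _ _ (lgt0 n.+1)) _.
  apply: le_trans (ler_wpM2l (ltW e0) (superm _ _ _ (lgt0 n.+1))).
  by rewrite !mulrDr !lerD //; apply: bad; rewrite ?lexx ?lerDl ?ln.
have [f fP] := choice step.
pose S := fix S n := if n is n'.+1 then f (n', S n') else (x0, y0).
have PS n : P n (S n).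
  elim: n => [|n IH]; first by rewrite /P /l /= expr0 divr1.
  by have [] := fP (n, S n) IH.
have S1 n : (S n).1 <= (S n.+1).1 <= (S n).1 + l n.+1.
  by have [] := fP (n, S n) (PS n).
have S2 n : (S n).2 <= (S n.+1).2 <= (S n).2 + l n.+1.
  by have [] := fP (n, S n) (PS n).
(* Nested intervals: left ends increase, right ends decrease, so every left end is below every right
   end and the supremum of the left ends lies in all intervals. *)
have conv (u : nat -> R) : (forall n, u n <= u n.+1 <= u n + l n.+1) ->
    exists p, forall n, u n <= p <= u n + l n.
  move=> Hu.
  have nd i j : (i <= j)%N -> u i <= u j.
    by move=> /subnK <-; elim: (j - i)%N => //= k IH; apply: le_trans IH _;
       rewrite addSn; case/andP: (Hu (k + i)%N).
  have ni i j : (i <= j)%N -> u j + l j <= u i + l i.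
    move=> /subnK <-; elim: (j - i)%N => //= k; apply: le_trans.
    rewrite addSn [in leRHS]lS addrA lerD2r.
    by case/andP: (Hu (k + i)%N).
  have ub i j : u i <= u j + l j.
    case: (leqP i j) => [ij|/ltnW ji].
      by apply: le_trans (nd _ _ ij) _; rewrite lerDl ltW.
    by apply: le_trans (ni _ _ ji); rewrite lerDl ltW.
  exists (sup (range u)) => n; apply/andP; split.
    apply: ub_le_sup; last by exists n.
    by exists (u 0%N + l 0%N) => _ [i _ <-].
  apply: ge_sup; first by exists (u 0%N), 0%N.
  by move=> _ [i _ <-].
have [p Hp] := conv _ S1; have [q Hq] := conv _ S2.
have [d d0 Hd] := locE p q e e0.
have [n ln] := exists_half_lt l0gt0 d0.
have := Hd _ _ _ (lgt0 n) ln (Hp n) (Hq n).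
by have := PS n; rewrite /P ltNge => /negP.
Qed.

End Bisection.

(** * Measurability of open sets and continuous functions of the plane *)

Section Plane.
Variable R : realType.
Local Notation C := (Cplane R).
Local Notation leb2 := (@lebesgue_measure R \x @lebesgue_measure R)%E.
Local Notation plane := (measurableTypeR R * measurableTypeR R)%type.

Lemma cre_pt (p : R * R) : cre (pt p) = p.1. Proof. by []. Qed.
Lemma cim_pt (p : R * R) : cim (pt p) = p.2. Proof. by []. Qed.

(** An open set is a countable union of open boxes with rational centre and half-side [1/(k+1)], and
    boxes are measurable for the product structure. *)
Lemma measurable_open_pt (O : set C) :
  (forall z, O z -> nbhs z O) -> measurable ((@pt R @^-1` O) : set plane).
Proof.
move=> Oo.
pose box (abk : rat * rat * nat) : set plane :=
  `](ratr abk.1.1 - abk.2.+1%:R^-1)%R, (ratr abk.1.1 + abk.2.+1%:R^-1)%R[%classic `*`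
  `](ratr abk.1.2 - abk.2.+1%:R^-1)%R, (ratr abk.1.2 + abk.2.+1%:R^-1)%R[%classic.
pose F (abk : rat * rat * nat) : set plane :=
  if `[< box abk `<=` @pt R @^-1` O >] then box abk else set0.
have -> : @pt R @^-1` O = \bigcup_abk F abk.
  apply/seteqP; split => [p Op|p [abk _]]; last first.
    by rewrite /F; case: asboolP => // h /h.
  have /nbhs_cabs[d d0 Hd] := Oo _ Op.
  (* With half-side [e < d/4], two points of a box differ by less than [2 e < d/2] in each
     coordinate, hence by less than [d] in modulus. *)
  have [k hk] : exists k : nat, k.+1%:R^-1 < d / 4.
    have d40 : 0 < d / 4 by rewrite divr_gt0.
    exists (Num.truncn (d / 4)^-1); rewrite invf_plt ?posrE //.
    by rewrite truncnS_gt // num_real.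
  have k0 : 0 < k.+1%:R^-1 :> R by rewrite invr_gt0.
  have [e eE] : exists e : R, e = k.+1%:R^-1 by exists k.+1%:R^-1.
  rewrite -eE in hk k0.
  have approx (x : R) : exists a : rat, x - e < ratr a /\ ratr a < x + e.
    have xx : x - e < x + e by rewrite ltrBlDr -addrA ltrDl addr_gt0.
    by have [a ha] := rat_in_itvoo xx; exists a; move: ha; rewrite in_itv => /andP.
  have [a [a1 a2]] := approx p.1; have [b [b1 b2]] := approx p.2.
  have bp : box (a, b, k) p.
    by split => /=; rewrite in_itv /= -eE; apply/andP; split; lra.
  exists (a, b, k) => //; rewrite /F; case: asboolP => // nsub; exfalso; apply: nsub.
  move=> q [] /=; rewrite !in_itv /= -eE => /andP[q1 q2] /andP[q3 q4]; apply: Hd.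
  apply: le_lt_trans (cabs_le _) _; rewrite creD creN cimD cimN !cre_pt !cim_pt.
  case: bp => /=; rewrite !in_itv /= -eE => /andP[p1 p2] /andP[p3 p4].
  have h1 : `|q.1 - p.1| < d / 2 by rewrite ltr_norml; apply/andP; split; lra.
  have h2 : `|q.2 - p.2| < d / 2 by rewrite ltr_norml; apply/andP; split; lra.
  lra.
apply: countable_bigcupT_measurable => // abk.
rewrite /F; case: asboolP => // _.
by apply: measurableX; exact: measurable_itv.
Qed.

Lemma measurable_continuous_pt (D : set C) (F : C -> R) :
  (forall z, D z -> nbhs z D) -> (forall z, D z -> {for z, continuous F}) ->
  measurable_fun (@pt R @^-1` D : set plane) (fun p => F (pt p)).
Proof.
move=> Do cF; apply: (measurability _ (RGenOInfty.measurableE R)).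
move=> /= _ [_ [a ->] <-].
have -> : @pt R @^-1` D `&` (fun p => F (pt p)) @^-1` `]a, +oo[%classic =
    @pt R @^-1` (D `&` [set z | a < F z]).
  by apply/seteqP; split => p [] /=; rewrite ?in_itv /= ?andbT.
apply: measurable_open_pt => z [Dz az]; apply: filterI; first exact: Do.
have /continuousRP := cF z Dz.
have d0 : 0 < F z - a by rewrite subr_gt0.
move=> /(_ _ d0)[d dgt0 Hd]; apply/nbhs_cabs; exists d => // w /Hd /=.
by rewrite ltr_norml => /andP[+ _]; lra.
Qed.

End Plane.

Lemma Rintegral_near_cst d (T : measurableType d) (R : realType)
    (mu : {measure set T -> \bar R}) (A : set T) (f : T -> R) (c e : R) :
  measurable A -> (mu A < +oo)%E -> mu.-integrable A (EFin \o f) ->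
  (forall x, A x -> `|f x - c| <= e) ->
  `|\int[mu]_(x in A) f x - c * fine (mu A)| <= e * fine (mu A).
Proof.
move=> mA Afin fi fc.
have ci (k : R) : mu.-integrable A (EFin \o (fun=> k)).
  apply: measurable_bounded_integrable => //; exact: bounded_cst.
have fci : mu.-integrable A (EFin \o (fun x => f x - c)).
  by apply: eq_integrable (integrableB mA fi (ci c)).
rewrite -(Rintegral_cst mu mA c) -RintegralB //.
apply: le_trans (le_normr_Rintegral mA fci) _.
rewrite -(Rintegral_cst mu mA e); apply: le_Rintegral => //.
have := integrable_norm fci; exact: eq_integrable.
Qed.

(** * Integrals over half-open intervals *)

Section Interval.
Variable R : realType.
Notation mu := (@lebesgue_measure R).
Implicit Types (f : R -> R) (a b l : R).

Lemma continuous_integrable_co f a b : continuous f ->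
  mu.-integrable `[a, b[ (EFin \o f).
Proof.
move=> cf; apply: (@integrableS _ _ _ mu `[a, b]).
- exact: measurable_itv.
- exact: measurable_itv.
- by apply: subset_itvl; rewrite bnd_simp.
- apply: continuous_compact_integrable; first exact: segment_compact.
  exact: continuous_subspaceT.
Qed.

Lemma Rintegral_co_split f a l : continuous f -> 0 <= l ->
  \int[mu]_(t in `[a, a + (l + l)[) f t =
  \int[mu]_(t in `[a, a + l[) f t + \int[mu]_(t in `[a + l, a + l + l[) f t.
Proof.
move=> cf l0; rewrite addrA (@itv_bndbnd_setU _ _ _ (BLeft (a + l))) ?bnd_simp ?lerDl //.
rewrite Rintegral_setU //; try exact: measurable_itv.
- rewrite -itv_bndbnd_setU ?bnd_simp ?lerDl //; exact: continuous_integrable_co.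
- apply/disj_set2P; rewrite -subset0 => x [] /=; rewrite !in_itv /=.
  by move=> /andP[_ xl] /andP[]; rewrite leNgt xl.
Qed.

Lemma fine_lebesgue_co a l : 0 <= l -> fine (mu `[a, a + l[) = l.
Proof.
move=> l0; rewrite lebesgue_measure_itv /= lte_fin ltrDl.
case: ltP => h; first by rewrite -EFinB /= addrC addKr.
by apply/eqP; rewrite eq_sym eq_le h l0.
Qed.

Lemma lebesgue_co_fin a b : (mu `[a, b[ < +oo)%E.
Proof. by rewrite lebesgue_measure_itv /=; case: ifP => _; rewrite -?EFinB ltry. Qed.

Lemma Rintegral_co_near_cst f a l c e : continuous f -> 0 <= l ->
  (forall t, a <= t <= a + l -> `|f t - c| <= e) ->
  `|\int[mu]_(t in `[a, a + l[) f t - c * l| <= e * l.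
Proof.
move=> cf l0 H; rewrite -[in c * l](fine_lebesgue_co a l0) -[in e * l](fine_lebesgue_co a l0).
apply: Rintegral_near_cst.
- exact: measurable_itv.
- exact: lebesgue_co_fin.
- exact: continuous_integrable_co.
- by move=> t /=; rewrite in_itv /= => /andP[ta tb]; apply: H; rewrite ta ltW.
Qed.

End Interval.

(** * Integrals over half-open squares *)

Section Square.
Variable R : realType.
Local Notation C := (Cplane R).
Local Notation mu := (@lebesgue_measure R).
Local Notation leb2 := (@lebesgue_measure R \x @lebesgue_measure R)%E.
Local Notation plane := (measurableTypeR R * measurableTypeR R)%type.
Implicit Types (x y l M : R).

(** Half-open on both axes, so that the four quarters of a square are disjoint and cover it
    exactly. *)
Definition square x y l : set plane := `[x, x + l[%classic `*` `[y, y + l[%classic.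

Lemma measurable_square x y l : measurable (square x y l).
Proof. by apply: measurableX; exact: measurable_itv. Qed.

Lemma square_fin x y l : (leb2 (square x y l) < +oo)%E.
Proof.
rewrite [X in (X < _)%E]product_measure1E; try exact: measurable_itv.
by rewrite lte_mul_pinfty ?ge0_fin_numE // ?lebesgue_co_fin.
Qed.

Lemma fine_square x y l : 0 <= l -> fine (leb2 (square x y l)) = l * l.
Proof.
move=> l0; rewrite [X in fine X]product_measure1E; try exact: measurable_itv.
rewrite fineM ?fine_lebesgue_co //; rewrite ge0_fin_numE //; exact: lebesgue_co_fin.
Qed.

Lemma bounded_integrable_pt (A : set plane) (F : C -> R) M :
  measurable A -> (leb2 A < +oo)%E -> (forall z, {for z, continuous F}) ->
  (forall z, `|F z| <= M) -> leb2.-integrable A (EFin \o (F \o @pt R)).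
Proof.
move=> mA Afin cF FM; apply: measurable_bounded_integrable => //.
- apply: measurable_funTS.
  have := @measurable_continuous_pt R setT F; rewrite preimage_setT; apply => //.
  by move=> z _; exact: filterT.
- exists M; split; first exact: num_real.
  by move=> N MN p _ /=; apply: le_trans (ltW MN).
Qed.

Lemma disjoint_square (x y x' y' l l' : R) :
  x + l <= x' \/ y + l <= y' -> [disjoint square x y l & square x' y' l'].
Proof.
move=> H; apply/disj_set2P; rewrite -subset0 => p [[/=]]; rewrite !in_itv /=.
move=> /andP[_ h1] /andP[_ h2] [/=]; rewrite !in_itv /= => /andP[h3 _] /andP[h4 _].
by case: H => H; lra.
Qed.

Lemma square_split x y l : 0 <= l -> square x y (l + l) =
  (square x y l `|` square (x + l) y l) `|` (square x (y + l) l `|` square (x + l) (y + l) l).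
Proof.
move=> l0; apply/seteqP; split=> p.
  move=> [/=]; rewrite !in_itv /= => /andP[x1 x2] /andP[y1 y2].
  have [xl|xl] := ltP p.1 (x + l); have [yl|yl] := ltP p.2 (y + l).
  - by left; left; split; rewrite /= in_itv /=; apply/andP; split.
  - by right; left; split; rewrite /= in_itv /=; apply/andP; split=> //; lra.
  - by left; right; split; rewrite /= in_itv /=; apply/andP; split=> //; lra.
  - by right; right; split; rewrite /= in_itv /=; apply/andP; split=> //; lra.
by move=> [[|]|[|]] [/=]; rewrite !in_itv /= => /andP[x1 x2] /andP[y1 y2];
  split; rewrite /= in_itv /=; apply/andP; split; lra.
Qed.

Lemma Rintegral_square_split (F : C -> R) M x y l : 0 <= l ->
  (forall z, {for z, continuous F}) -> (forall z, `|F z| <= M) ->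
  let I x y l := \int[leb2]_(p in square x y l) F (pt p) in
  I x y (l + l) = I x y l + I (x + l) y l + I x (y + l) l + I (x + l) (y + l) l.
Proof.
move=> l0 cF FM /=.
have ms := measurable_square.
have sqi : leb2.-integrable (square x y (l + l)) (EFin \o (F \o @pt R)).
  by apply: (bounded_integrable_pt (M := M)) => //; exact: square_fin.
have mU1 : measurable (square x y l `|` square (x + l) y l) by exact: measurableU.
have mU2 : measurable (square x (y + l) l `|` square (x + l) (y + l) l).
  exact: measurableU.
rewrite square_split // in sqi *.
rewrite [LHS]Rintegral_setU //; last first.
  apply/disj_set2P; rewrite -subset0 => p [h1 h2].
  have {h1} h1 : p.2 < y + l.
    by case: h1 => [] [_ /=]; rewrite in_itv /= => /andP[].
  have : y + l <= p.2.
    by case: h2 => [] [_ /=]; rewrite in_itv /= => /andP[].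
  by rewrite leNgt h1.
rewrite !Rintegral_setU //; first by rewrite !addrA.
- by apply: integrableS sqi => //; exact: measurableU.
- by apply: disjoint_square; left.
- by apply: integrableS sqi => //; exact: measurableU.
- by apply: disjoint_square; left.
Qed.

End Square.

(** * Green's formula on squares, then on the disk *)

Section Green.
Variable R : realType.
Local Notation C := (Cplane R).
Local Notation mu := (@lebesgue_measure R).
Local Notation leb2 := (@lebesgue_measure R \x @lebesgue_measure R)%E.
Local Notation plane := (measurableTypeR R * measurableTypeR R)%type.
Local Notation D2 := (disk2 (R := R) : set plane).
Implicit Types (x y l M e d t : R) (G D : C -> C).

Lemma cabs_pt_le (x y : R) (z : C) (l : R) :
  x <= cre z <= x + l -> y <= cim z <= y + l ->
  forall s t, x <= s <= x + l -> y <= t <= y + l -> cabs (pt (s, t) - z) <= 2 * l.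
Proof.
move=> /andP[x1 x2] /andP[y1 y2] s t /andP[s1 s2] /andP[t1 t2].
apply: le_trans (cabs_le _) _; rewrite creD creN cimD cimN cre_pt cim_pt /=.
have h1 : `|s - cre z| <= l by rewrite ler_norml; apply/andP; split; lra.
have h2 : `|t - cim z| <= l by rewrite ler_norml; apply/andP; split; lra.
lra.
Qed.

Lemma continuous_vslice (F : C -> R) x : (forall z, {for z, continuous F}) ->
  continuous (fun t => F (pt (x, t))).
Proof.
move=> cF t; apply/cvgrPdist_lt => e e0.
have /continuousRP/(_ _ e0)[d d0 Hd] := cF (pt (x, t)).
apply/nbhs_ballP; exists d => // s st; have {}st : `|t - s| < d := st.
rewrite distrC; apply: Hd; apply: le_lt_trans (cabs_le _) _.
by rewrite creD creN cimD cimN !cre_pt !cim_pt /= subrr normr0 add0r distrC.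
Qed.

Lemma continuous_hslice (F : C -> R) y : (forall z, {for z, continuous F}) ->
  continuous (fun t => F (pt (t, y))).
Proof.
move=> cF t; apply/cvgrPdist_lt => e e0.
have /continuousRP/(_ _ e0)[d d0 Hd] := cF (pt (t, y)).
apply/nbhs_ballP; exists d => // s st; have {}st : `|t - s| < d := st.
rewrite distrC; apply: Hd; apply: le_lt_trans (cabs_le _) _.
by rewrite creD creN cimD cimN !cre_pt !cim_pt /= subrr normr0 addr0 distrC.
Qed.

Definition vint (F : C -> R) x y l := \int[mu]_(t in `[y, y + l[) F (pt (x, t)).
Definition hint (F : C -> R) x y l := \int[mu]_(t in `[x, x + l[) F (pt (t, y)).

(* Real part of (1/i) times the integral of G dz along the boundary of the square. *)
Definition flux G x y l :=
  (vint (fun z => cre (G z)) (x + l) y l - vint (fun z => cre (G z)) x y l) -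
  (hint (fun z => cim (G z)) x (y + l) l - hint (fun z => cim (G z)) x y l).

(** The boundary integral of [G dz] is [2i] times the area integral of the conjugate derivative, so
    Green's formula says that this vanishes when [D] is that derivative. *)
Definition defect G D x y l :=
  flux G x y l - 2 * \int[leb2]_(p in square x y l) cre (D (pt p)).

Lemma continuous_creG G : (forall z, {for z, continuous G}) ->
  forall z, {for z, continuous (fun z => cre (G z))}.
Proof. by move=> cG z; exact: (continuous_comp (cG z) (continuous_cre (z := _))). Qed.

Lemma continuous_cimG G : (forall z, {for z, continuous G}) ->
  forall z, {for z, continuous (fun z => cim (G z))}.
Proof. by move=> cG z; exact: (continuous_comp (cG z) (continuous_cim (z := _))). Qed.

(** The inner edges are traversed once in each direction; the final [ring] cancels them. *)
Lemma defect_split G D M x y l : (forall z, {for z, continuous G}) ->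
  (forall z, {for z, continuous D}) -> (forall z, cabs (D z) <= M) -> 0 <= l ->
  defect G D x y (l + l) = defect G D x y l + defect G D (x + l) y l +
    defect G D x (y + l) l + defect G D (x + l) (y + l) l.
Proof.
move=> cG cD DM l0; rewrite /defect /flux.
have DM' z : `|cre (D z)| <= M := le_trans (ler_cre_cabs _) (DM z).
have /= -> := Rintegral_square_split x y l0 (continuous_creG cD) DM'.
have vs F a b : (forall z, {for z, continuous F}) ->
    vint F a b (l + l) = vint F a b l + vint F a (b + l) l.
  by move=> cF; apply: Rintegral_co_split => //; exact: continuous_vslice.
have hs F a b : (forall z, {for z, continuous F}) ->
    hint F a b (l + l) = hint F a b l + hint F (a + l) b l.
  by move=> cF; apply: Rintegral_co_split => //; exact: continuous_hslice.
have cre' := continuous_creG cG; have cim' := continuous_cimG cG.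
rewrite !(vs _ _ _ cre') !(hs _ _ _ cim') !addrA.
by ring.
Qed.

Lemma vint_near_cst (F : C -> R) x y l c e : (forall z, {for z, continuous F}) -> 0 <= l ->
  (forall t, y <= t <= y + l -> `|F (pt (x + l, t)) - F (pt (x, t)) - c| <= e) ->
  `|vint F (x + l) y l - vint F x y l - c * l| <= e * l.
Proof.
move=> cF l0 H; rewrite /vint -RintegralB; last first.
- exact/continuous_integrable_co/continuous_vslice.
- exact/continuous_integrable_co/continuous_vslice.
- exact: measurable_itv.
apply: Rintegral_co_near_cst => // t.
by apply: cvgB; exact: continuous_vslice.
Qed.

Lemma hint_near_cst (F : C -> R) x y l c e : (forall z, {for z, continuous F}) -> 0 <= l ->
  (forall t, x <= t <= x + l -> `|F (pt (t, y + l)) - F (pt (t, y)) - c| <= e) ->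
  `|hint F x (y + l) l - hint F x y l - c * l| <= e * l.
Proof.
move=> cF l0 H; rewrite /hint -RintegralB; last first.
- exact/continuous_integrable_co/continuous_hslice.
- exact/continuous_integrable_co/continuous_hslice.
- exact: measurable_itv.
apply: Rintegral_co_near_cst => // t.
by apply: cvgB; exact: continuous_hslice.
Qed.

Lemma square_near_cst D M x y l c e : (forall z, {for z, continuous D}) ->
  (forall z, cabs (D z) <= M) -> 0 <= l ->
  (forall s t, x <= s <= x + l -> y <= t <= y + l -> `|cre (D (pt (s, t))) - c| <= e) ->
  `|\int[leb2]_(p in square x y l) cre (D (pt p)) - c * (l * l)| <= e * (l * l).
Proof.
move=> cD DM l0 H.
have DM' z : `|cre (D z)| <= M := le_trans (ler_cre_cabs _) (DM z).
rewrite -(fine_square x y l0); apply: Rintegral_near_cst.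
- exact: measurable_square.
- exact: square_fin.
- apply: (bounded_integrable_pt (F := fun z => cre (D z)) (M := M)).
  + exact: measurable_square.
  + exact: square_fin.
  + exact: continuous_creG.
  + exact: DM'.
- move=> [s t] [/=]; rewrite !in_itv /= => /andP[s1 s2] /andP[t1 t2].
  by apply: H; apply/andP; split=> //; exact: ltW.
Qed.

(** For the affine part of [G] at [z], the vertical sides give [Re (A + D z) l^2] and the horizontal
    ones [Re (A - D z) l^2]. Their difference [2 Re (D z) l^2] is cancelled by the area term for the
    constant [D z], so only the remainder [r] and the oscillation of [D] are left. *)
Lemma defect_local G D M z A e : (forall z, {for z, continuous G}) ->
  (forall z, {for z, continuous D}) -> (forall z, cabs (D z) <= M) ->
  rdiff G z A (D z) -> 0 < e ->
  exists2 d, 0 < d & forall x y l, 0 < l -> l < d ->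
    x <= cre z <= x + l -> y <= cim z <= y + l -> `|defect G D x y l| <= e * (l * l).
Proof.
move=> cG cD DM [a [b [H ca cb az bz]]] e0.
(* [18 = 8 + 8 + 2]: each pair of opposite sides contributes at most [8 e' l^2] since
   [|r| <= 4 e' l], and the oscillation of [D] at most [2 e' l^2]. *)
have e'0 : 0 < e / 18 by rewrite divr_gt0.
have /continuousCP/(_ _ e'0)[d1 d10 H1] := ca.
have /continuousCP/(_ _ e'0)[d2 d20 H2] := cb.
have /continuousCP/(_ _ e'0)[d3 d30 H3] := cD z.
set e' := e / 18 in e'0 H1 H2 H3.
(* Halved because points of the square are only known to be within [2 l] of [z]. *)
exists (Num.min (Num.min d1 d2) d3 / 2).
  by rewrite divr_gt0 // !lt_min d10 d20 d30.
move=> x y l l0; rewrite ltr_pdivlMr // !lt_min => /andP[/andP[l1 l2] l3] hx hy.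
have near s t := cabs_pt_le hx hy (s := s) (t := t).
pose r w := G w - G z - A * (w - z) - D z * cconj (w - z).
have rle s t : x <= s <= x + l -> y <= t <= y + l -> cabs (r (pt (s, t))) <= 4 * e' * l.
  move=> hs ht; have hw := near _ _ hs ht; set w := pt (s, t) in hw *.
  have -> : r w = (a w - a z) * (w - z) + (b w - b z) * cconj (w - z).
    by rewrite /r H az bz; ring.
  apply: le_trans (cabsD _ _) _; rewrite !cabsM cabsJ -mulrDl.
  have h1 : cabs (a w - a z) <= e' by apply/ltW/H1; lra.
  have h2 : cabs (b w - b z) <= e' by apply/ltW/H2; lra.
  have -> : 4 * e' * l = (e' + e') * (2 * l) by ring.
  by apply: ler_pM => //; rewrite ?addr_ge0 ?cabs_ge0 ?lerD.
have GE w w' : G w - G w' = A * (w - w') + D z * cconj (w - w') + (r w - r w').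
  by rewrite /r !cconjD !cconjN; ring.
have ptd s t s' t' : pt (s, t) - pt (s', t') = pt (s - s', t - t') :> C.
  by [].
have lx : x <= x <= x + l by rewrite lexx lerDl ltW.
have lx' : x <= x + l <= x + l by rewrite lexx lerDl ltW.
have ly : y <= y <= y + l by rewrite lexx lerDl ltW.
have ly' : y <= y + l <= y + l by rewrite lexx lerDl ltW.
have V : `|vint (fun z => cre (G z)) (x + l) y l - vint (fun z => cre (G z)) x y l
    - (cre (A + D z) * l) * l| <= (8 * e' * l) * l.
  apply: vint_near_cst; [exact: continuous_creG|exact: ltW|move=> t ht].
  rewrite -creN -creD GE ptd subrr.
  have -> : x + l - x = l by ring.
  have -> : pt (l, 0) = creal l :> C by [].
  have -> : cre (A * creal l + D z * cconj (creal l) +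
       (r (pt (x + l, t)) - r (pt (x, t)))) - cre (A + D z) * l =
      cre (r (pt (x + l, t)) - r (pt (x, t))).
    by rewrite cconjR !creD !creM creR cimR; ring.
  apply: le_trans (ler_cre_cabs _) (le_trans (cabsD _ _) _); rewrite cabsN.
  have := rle _ _ lx ht; have := rle _ _ lx' ht; lra.
have W : `|hint (fun z => cim (G z)) x (y + l) l - hint (fun z => cim (G z)) x y l
    - (cre (A - D z) * l) * l| <= (8 * e' * l) * l.
  apply: hint_near_cst; [exact: continuous_cimG|exact: ltW|move=> t ht].
  rewrite -cimN -cimD GE ptd subrr.
  have -> : y + l - y = l by ring.
  have -> : cim (A * pt (0, l) + D z * cconj (pt (0, l)) + (r (pt (t, y + l)) - r (pt (t, y))))
     - cre (A - D z) * l = cim (r (pt (t, y + l)) - r (pt (t, y))).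
    by rewrite !cimD !cimM cimJ creJ !cre_pt !cim_pt /= creD creN; ring.
  apply: le_trans (ler_cim_cabs _) (le_trans (cabsD _ _) _); rewrite cabsN.
  have := rle _ _ ht ly; have := rle _ _ ht ly'; lra.
have S : `|\int[leb2]_(p in square x y l) cre (D (pt p)) - cre (D z) * (l * l)|
    <= e' * (l * l).
  apply: (square_near_cst (M := M)) => //; first exact: ltW.
  move=> s t hs ht; rewrite -creN -creD.
  apply: le_trans (ler_cre_cabs _) _; apply/ltW/H3.
  by have := near _ _ hs ht; lra.
rewrite /defect /flux.
move: V W S; move: (vint _ _ _ _ - _) => v; move: (hint _ _ _ _ - _) => h.
move: (Rintegral _ _ _) => s.
rewrite creD [cre (A - _)]creD creN /e' !ler_norml.
move=> /andP[V1 V2] /andP[W1 W2] /andP[S1 S2]; apply/andP; split; lra.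
Qed.

(** Continuity alone makes the flux [o(l)] instead of [o(l^2)]; this is the estimate for the
    exceptional point. *)
Lemma defect_local_continuous G D M z e : (forall z, {for z, continuous G}) ->
  (forall z, {for z, continuous D}) -> (forall z, cabs (D z) <= M) -> 0 < e ->
  exists2 d, 0 < d & forall x y l, 0 < l -> l < d ->
    x <= cre z <= x + l -> y <= cim z <= y + l -> `|defect G D x y l| <= e * l.
Proof.
move=> cG cD DM e0.
have M0 : 0 <= M := le_trans (cabs_ge0 _) (DM 0).
(* Each pair of sides contributes [2 e' l], in total [e l / 2]. The area term is at most
   [2 M l^2 <= e l / 2] by the second bound on [l], where [M + 1] avoids dividing by 0. *)
have e'0 : 0 < e / 8 by rewrite divr_gt0.
have /continuousCP/(_ _ e'0)[d d0 Hd] := cG z.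
set e' := e / 8 in e'0 Hd.
have K0 : 0 < 4 * (M + 1) by lra.
exists (Num.min (d / 2) (e / (4 * (M + 1)))).
  by rewrite lt_min !divr_gt0.
move=> x y l l0; rewrite lt_min !ltr_pdivlMr // => /andP[l1 l2] hx hy.
have near s t := cabs_pt_le hx hy (s := s) (t := t).
have Gle s t : x <= s <= x + l -> y <= t <= y + l -> cabs (G (pt (s, t)) - G z) <= e'.
  by move=> hs ht; apply/ltW/Hd; have := near _ _ hs ht; lra.
have lx : x <= x <= x + l by rewrite lexx lerDl ltW.
have lx' : x <= x + l <= x + l by rewrite lexx lerDl ltW.
have ly : y <= y <= y + l by rewrite lexx lerDl ltW.
have ly' : y <= y + l <= y + l by rewrite lexx lerDl ltW.
have GG s t s' t' : x <= s <= x + l -> y <= t <= y + l -> x <= s' <= x + l ->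
    y <= t' <= y + l -> cabs (G (pt (s, t)) - G (pt (s', t'))) <= 2 * e'.
  move=> h1 h2 h3 h4.
  have -> : G (pt (s, t)) - G (pt (s', t')) =
    (G (pt (s, t)) - G z) - (G (pt (s', t')) - G z) by ring.
  apply: le_trans (cabsD _ _) _; rewrite cabsN.
  by have := Gle _ _ h1 h2; have := Gle _ _ h3 h4; lra.
have V : `|vint (fun z => cre (G z)) (x + l) y l - vint (fun z => cre (G z)) x y l
    - 0 * l| <= (2 * e') * l.
  apply: vint_near_cst; [exact: continuous_creG|exact: ltW|move=> t ht].
  rewrite subr0 -creN -creD; apply: le_trans (ler_cre_cabs _) _; exact: GG.
have W : `|hint (fun z => cim (G z)) x (y + l) l - hint (fun z => cim (G z)) x y l
    - 0 * l| <= (2 * e') * l.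
  apply: hint_near_cst; [exact: continuous_cimG|exact: ltW|move=> t ht].
  rewrite subr0 -cimN -cimD; apply: le_trans (ler_cim_cabs _) _; exact: GG.
have S : `|\int[leb2]_(p in square x y l) cre (D (pt p)) - 0 * (l * l)|
    <= M * (l * l).
  apply: (square_near_cst (M := M)) => //; first exact: ltW.
  by move=> s t hs ht; rewrite subr0; apply: le_trans (ler_cre_cabs _) _.
have K : M * (l * l) <= e / 4 * l.
  rewrite mulrA ler_wpM2r ?ltW //.
  have : l * (4 * (M + 1)) = 4 * (M * l) + 4 * l by ring.
  by lra.
rewrite /defect /flux.
move: V W S; move: (vint _ _ _ _ - _) => v; move: (hint _ _ _ _ - _) => h.
move: (Rintegral _ _ _) => s.
rewrite !mul0r !subr0 /e' !ler_norml.
move=> /andP[V1 V2] /andP[W1 W2] /andP[S1 S2]; apply/andP; split; lra.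
Qed.

(** Signed square root, chosen for its infinite slope at 0: over an interval of length [l]
    containing 0 it grows by at least [sqrt l], so the product of two such increments is at least
    [l]. *)
Definition ssqrt (x : R) := Num.sg x * Num.sqrt `|x|.

Lemma ssqrt_ge0 x : 0 <= x -> ssqrt x = Num.sqrt x.
Proof.
rewrite /ssqrt le_eqVlt => /predU1P[<-|x0]; first by rewrite sgr0 sqrtr0 mul0r.
by rewrite gtr0_sg // mul1r gtr0_norm.
Qed.

Lemma ssqrt_le0 x : x <= 0 -> ssqrt x = - Num.sqrt (- x).
Proof.
rewrite /ssqrt le_eqVlt => /predU1P[->|x0]; first by rewrite sgr0 oppr0 sqrtr0 mul0r oppr0.
by rewrite ltr0_sg // mulN1r ltr0_norm.
Qed.

Lemma ssqrt_nd x y : x <= y -> ssqrt x <= ssqrt y.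
Proof.
move=> xy; have [x0|x0] := leP 0 x; have [y0|y0] := leP 0 y.
- by rewrite !ssqrt_ge0 // ler_wsqrtr.
- lra.
- rewrite (ssqrt_le0 (ltW x0)) (ssqrt_ge0 y0).
  by apply: (@le_trans _ _ 0); rewrite ?oppr_le0 sqrtr_ge0.
- rewrite (ssqrt_le0 (ltW x0)) (ssqrt_le0 (ltW y0)).
  have h : - y <= - x by lra.
  by have := ler_wsqrtr h; lra.
Qed.

(** Subadditivity of the square root, [sqrt (a + b) <= sqrt a + sqrt b], with [a = x + l] and
    [b = - x]. *)
Lemma ssqrt_incr x l : x <= 0 -> 0 <= x + l -> Num.sqrt l <= ssqrt (x + l) - ssqrt x.
Proof.
move=> x0 xl; rewrite ssqrt_ge0 // ssqrt_le0 // opprK.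
have l0 : 0 <= l by lra.
rewrite -(ler_pXn2r (n := 2)) ?nnegrE ?addr_ge0 ?sqrtr_ge0 //.
rewrite sqr_sqrtr // sqrrD !sqr_sqrtr ?oppr_ge0 //.
have := mulr_ge0 (sqrtr_ge0 (x + l)) (sqrtr_ge0 (- x)).
by rewrite mulr2n; lra.
Qed.

(* The set function m below is additive, at least l^2 on every square, and at least l on
   the squares containing xi: bisecting relative to m rather than to the area absorbs the
   point where G is only continuous. *)
Lemma defect0 G D M (xi : C) : (forall z, {for z, continuous G}) ->
  (forall z, {for z, continuous D}) -> (forall z, cabs (D z) <= M) ->
  (forall z, z != xi -> exists A, rdiff G z A (D z)) ->
  forall x y l, 0 < l -> defect G D x y l = 0.
Proof.
move=> cG cD DM dG.
pose g t := ssqrt (t - cre xi); pose h t := ssqrt (t - cim xi).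
pose m x y l := l * l + (g (x + l) - g x) * (h (y + l) - h y).
have gnd x l : 0 <= l -> 0 <= g (x + l) - g x.
  by move=> l0; rewrite subr_ge0 ssqrt_nd // lerD2r lerDl.
have hnd x l : 0 <= l -> 0 <= h (x + l) - h x.
  by move=> l0; rewrite subr_ge0 ssqrt_nd // lerD2r lerDl.
apply: (bisection (m := m)).
- move=> x y l l0; rewrite (defect_split _ _ cG cD DM (ltW l0)).
  by do 2![apply: le_trans (ler_normD _ _) _; rewrite lerD2r]; exact: ler_normD.
- by move=> x y l l0; rewrite /m !addrA le_eqVlt; apply/orP; left; apply/eqP; ring.
move=> p q e e0; have [zxi|zxi] := eqVneq (pt (p, q)) xi.
  have [d d0 Hd] := defect_local_continuous (pt (p, q)) cG cD DM e0.
  exists d => // x y l l0 ld hx hy; apply: le_trans (Hd x y l l0 ld hx hy) _.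
  rewrite ler_pM2l // /m.
  have : x <= cre (pt (p, q)) <= x + l := hx.
  have : y <= cim (pt (p, q)) <= y + l := hy.
  rewrite zxi => /andP[y1 y2] /andP[x1 x2].
  have hg : Num.sqrt l <= g (x + l) - g x.
    by rewrite /g (addrAC x) ssqrt_incr //; lra.
  have hh : Num.sqrt l <= h (y + l) - h y.
    by rewrite /h (addrAC y) ssqrt_incr //; lra.
  have := ler_pM (sqrtr_ge0 l) (sqrtr_ge0 l) hg hh.
  rewrite -expr2 sqr_sqrtr; last exact: ltW.
  have : 0 <= l * l by rewrite mulr_ge0 ?ltW.
  lra.
have [A dA] := dG _ zxi.
have [d d0 Hd] := defect_local cG cD DM dA e0.
exists d => // x y l l0 ld hx hy; apply: le_trans (Hd x y l l0 ld hx hy) _.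
rewrite ler_pM2l // /m lerDl mulr_ge0 //; [exact: gnd (ltW _)|exact: hnd (ltW _)].
Qed.

Lemma nbhs_disk (z : C) : disk z -> nbhs z (@disk R).
Proof.
move=> z1; apply/nbhs_cabs; exists (1 - cabs z) => [|w wz]; first by rewrite subr_gt0.
have -> : w = z + (w - z) by rewrite addrC subrK.
by apply: le_lt_trans (cabsD _ _) _; rewrite -ltrBrDl.
Qed.

Lemma measurable_disk2 : measurable D2.
Proof. exact: measurable_open_pt (@nbhs_disk). Qed.

Lemma disk2_sub_square : D2 `<=` square (-1) (-1) 2.
Proof.
move=> [s t] h; have {}h : cabs (pt (s, t)) < 1 := h.
have := le_lt_trans (ler_cre_cabs _) h; have := le_lt_trans (ler_cim_cabs _) h.
rewrite cre_pt cim_pt /= !ltr_norml => /andP[? ?] /andP[? ?].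
by split; rewrite /= in_itv /=; apply/andP; split; lra.
Qed.

Lemma green G D M (xi : C) : (forall z, {for z, continuous G}) ->
  (forall z, {for z, continuous D}) -> (forall z, cabs (D z) <= M) ->
  (forall z, z != xi -> exists A, rdiff G z A (D z)) ->
  (forall z, 1 <= cabs z -> G z = 0) -> (forall z, 1 <= cabs z -> D z = 0) ->
  \int[leb2]_(p in D2) cre (D (pt p)) = 0.
Proof.
move=> cG cD DM dG G0 D0.
have two0 : (0 : R) < 2 by [].
(* The square of side 2 around the disk has its edges in [|w| >= 1], where [G] vanishes, so its flux
   is 0; on the rest of the square outside the disk [D] vanishes. *)
have := defect0 cG cD DM dG (-1) (-1) two0; rewrite /defect /flux.
have -> : -1 + 2 = 1 :> R by ring.
have v0 (F : C -> R) x y l : (forall t, F (pt (x, t)) = 0) -> vint F x y l = 0.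
  by move=> F0; rewrite /vint (eq_Rintegral _ (g := fun=> 0)) ?Rintegral_cst ?mul0r.
have h0 (F : C -> R) x y l : (forall t, F (pt (t, y)) = 0) -> hint F x y l = 0.
  by move=> F0; rewrite /hint (eq_Rintegral _ (g := fun=> 0)) ?Rintegral_cst ?mul0r.
have big (w : C) : 1 <= `|cre w| \/ 1 <= `|cim w| -> G w = 0.
  case=> h; apply: G0; apply: le_trans h _; [exact: ler_cre_cabs|exact: ler_cim_cabs].
rewrite !v0 ?h0; first last.
- by move=> t; rewrite big //; left; rewrite cre_pt /= ?normrN normr1.
- by move=> t; rewrite big //; left; rewrite cre_pt /= ?normrN normr1.
- by move=> t; rewrite big //; right; rewrite cim_pt /= ?normrN normr1.
- by move=> t; rewrite big //; right; rewrite cim_pt /= ?normrN normr1.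
rewrite !subrr sub0r => /eqP; rewrite oppr_eq0 mulf_eq0 pnatr_eq0 /= => /eqP <-.
rewrite -(setIidr disk2_sub_square) Rintegral_mkcondr; apply: eq_Rintegral => p _.
rewrite patchE; case: ifPn => // /negP; rewrite inE => pd.
have /D0 -> // : 1 <= cabs (pt p).
by rewrite leNgt; apply/negP.
Qed.

End Green.

Arguments measurable_disk2 {R}.

(** * The principal power *)

Section ComplexPower.
Variable R : realType.
Local Notation C := (Cplane R).
Implicit Types (z w u v : C) (s t : R).

Definition ci : C := 0 +i* 1.

Lemma cconj_ci : cconj ci = - ci.
Proof.
apply: complexP; first by rewrite creJ creN /cre /= oppr0.
by rewrite cimJ cimN.
Qed.

Lemma ci_neq0 : ci != 0.
Proof.
by rewrite -cabs_eq0 -sqrf_eq0 cabs_sqr /cre /cim /= expr0n expr1n add0r oner_neq0.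
Qed.

Lemma rdiff_unique (F : C -> C) z A B A' B' :
  rdiff F z A B -> rdiff F z A' B' -> A = A' /\ B = B'.
Proof.
move=> [a [b [H ca cb <- <-]]] [a' [b' [H' ca' cb' <- <-]]].
(* Up to a nonzero factor, [f] and [g] are the difference of the two expansions along the directions
   1 and [i]. They vanish on these lines off [z], hence at [z] by continuity. *)
pose f w := (a w - a' w) + (b w - b' w); pose g w := (a w - a' w) - (b w - b' w).
have cd : {for z, continuous (fun w => a w - a' w)}.
  exact: continuousD_C ca (continuousN_C ca').
have ce : {for z, continuous (fun w => b w - b' w)}.
  exact: continuousD_C cb (continuousN_C cb').
have cf : {for z, continuous f} by exact: continuousD_C cd ce.
have cg : {for z, continuous g} by exact: continuousD_C cd (continuousN_C ce).
have eq0 w : (a w - a' w) * (w - z) + (b w - b' w) * cconj (w - z) = 0.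
  have -> : (a w - a' w) * (w - z) + (b w - b' w) * cconj (w - z) =
    (a w * (w - z) + b w * cconj (w - z)) - (a' w * (w - z) + b' w * cconj (w - z)) by ring.
  by rewrite -H -H' subrr.
have zero (h : C -> C) (v : C) : v != 0 -> {for z, continuous h} ->
    (forall t, t != 0 -> h (z + creal t * v) = 0) -> h z = 0.
  move=> v0 ch h0; apply/eqP; rewrite -cabs_eq0 -[_ == _]negbK; apply/negP.
  rewrite cabs_eq0 -cabs_gt0 => hz.
  have /continuousCP/(_ _ hz)[d d0 Hd] := ch.
  have vp : 0 < cabs v by rewrite cabs_gt0.
  have t0 : 0 < d / 2 / cabs v by rewrite !divr_gt0.
  have hw : cabs (z + creal (d / 2 / cabs v) * v - z) < d.
    rewrite [z + _]addrC addrK cabsM cabsR ger0_norm ?(ltW t0) //.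
    by rewrite divfK ?gt_eqF //; lra.
  by have := Hd _ hw; rewrite h0 ?gt_eqF // sub0r cabsN ltxx.
have f0 : f z = 0.
  apply: (zero _ 1) cf _; first exact: oner_neq0.
  move=> t t0; have := eq0 (z + creal t * 1).
  rewrite [z + _ - z]addrC addKr mulr1 cconjR -mulrDl => /eqP.
  by rewrite mulf_eq0 creal_eq0 (negbTE t0) orbF => /eqP.
have g0 : g z = 0.
  apply: (zero _ ci) cg _; first exact: ci_neq0.
  move=> t t0; have := eq0 (z + creal t * ci).
  rewrite [z + _ - z]addrC addKr cconjM cconjR cconj_ci.
  set w := z + _; have -> : (a w - a' w) * (creal t * ci) + (b w - b' w) * (creal t * - ci) =
    g w * (creal t * ci) by rewrite /g; ring.
  move=> /eqP; rewrite !mulf_eq0 creal_eq0 (negbTE t0) (negbTE ci_neq0) => /orP[/eqP //|].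
  by [].
have two (x : C) : x + x = 0 -> x = 0.
  move=> xx; have : x * creal 2 = 0 by rewrite crealD creal1 mulrDr mulr1.
  by move/eqP; rewrite mulf_eq0 creal_eq0 pnatr_eq0 orbF => /eqP.
have a0 : a z - a' z = 0.
  by apply: two; rewrite -[RHS](addr0 0) -{1}f0 -g0 /f /g; ring.
have b0 : b z - b' z = 0 by move: f0; rewrite /f a0 add0r.
by split; apply/eqP; rewrite -subr_eq0 ?a0 ?b0.
Qed.

Definition cexp u : C := creal (expR (cre u)) * (cos (cim u) +i* sin (cim u)).

Lemma cexpD u v : cexp (u + v) = cexp u * cexp v.
Proof.
rewrite /cexp creD cimD expRD cosD sinD; apply: complexP; rewrite !(creM, cimM) !(creR, cimR).
  by rewrite /cre /cim /=; ring.
by rewrite /cre /cim /=; ring.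
Qed.

Lemma cabs_cexp u : cabs (cexp u) = expR (cre u).
Proof.
rewrite /cexp cabsM cabsR ger0_norm ?expR_ge0 // -[RHS]mulr1; congr (_ * _).
by apply/eqP; rewrite -(eqrXn2 (n := 2)) ?cabs_ge0 // cabs_sqr /cre /cim /= cos2Dsin2 expr1n.
Qed.

Lemma rdiff_cexp u : rdiff cexp u (cexp u) 0.
Proof.
(* Functions of [Im w] reduce to functions of [Re], because [Im w = Re (- i w)]. *)
have him (f : R -> R) f' : is_derive (cim u) (1 : R) f f' ->
    rdiff (fun w => creal (f (cim w))) u (- ci * creal (f' / 2)) (ci * creal (f' / 2)).
  move=> df.
  have dG : rdiff (fun w => - ci * w) u (- ci) 0.
    have := rdiffM (rdiff_cst (- ci) u) (rdiff_id u).
    by rewrite !mul0r mulr0 mulr1 addr0 add0r.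
  have cimE w : cre (- ci * w) = cim w by rewrite creM /cre /cim /=; ring.
  have df' : is_derive (cre (- ci * u)) (1 : R) f f' by rewrite cimE.
  have := rdiff_comp dG (rdiff_real df').
  have -> : (fun w => creal (f (cre (- ci * w)))) = (fun w => creal (f (cim w))).
    by apply/funext => w; rewrite cimE.
  rewrite cconjN cconj_ci opprK.
  by rewrite cconj0 !mulr0 addr0 add0r ![creal _ * _]mulrC.
have dc := him _ _ (is_derive_cos (cim u)).
have ds := him _ _ (is_derive_sin (cim u)).
have := rdiffM (rdiff_real (is_derive_expR (cre u))) (rdiffD dc (rdiffM (rdiff_cst ci u) ds)).
have -> : (fun w => creal (expR (cre w)) * (creal (cos (cim w)) + ci * creal (sin (cim w)))) = cexp.
  apply/funext => w; rewrite /cexp; congr (_ * _).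
  by apply: complexP; rewrite ?creD ?cimD ?creM ?cimM !(creR, cimR) /cre /cim /=; ring.
set A := _ + _ * _; set B := (X in rdiff _ _ _ X).
have -> : A = cexp u.
  by apply: complexP; rewrite /A /cexp /ci /cre /cim /=; field.
have -> : B = 0.
  by apply: complexP; rewrite /B /cexp /ci /cre /cim /=; field.
by [].
Qed.

Definition clog z : C := ln (cabs z) +i* carg z.

Lemma Re_div_cabs z : z != 0 -> -1 <= cre z / cabs z <= 1.
Proof.
move=> z0; have zp : 0 < cabs z by rewrite cabs_gt0.
have := ler_cre_cabs z; rewrite ler_norml => /andP[h1 h2].
by rewrite ler_pdivlMr // mulN1r h1 ler_pdivrMr // mul1r.
Qed.

Lemma cexp_clog z : z != 0 -> cexp (clog z) = z.
Proof.
move=> z0; have zp : 0 < cabs z by rewrite cabs_gt0.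
have hr := Re_div_cabs z0.
rewrite /cexp; have -> : cre (clog z) = ln (cabs z) by [].
have -> : cim (clog z) = carg z by [].
rewrite lnK ?posrE //.
have hc : cos (carg z) = cre z / cabs z.
  rewrite /carg -/(cre z); case: ifP => _; rewrite ?cosN acosK //.
have sa : sin (acos (cre z / cabs z)) = `|cim z| / cabs z.
  rewrite sin_acos // -(ger0_norm (divr_ge0 (normr_ge0 _) (ltW zp))) -sqrtr_sqr.
  congr Num.sqrt; rewrite !exprMn !exprVn cabs_sqr real_normK ?num_real //.
  by rewrite -cabs_sqr; have := cabs_sqr z => E; rewrite -{1}(divff (x := cabs z ^+ 2)) ?sqrf_eq0 ?gt_eqF // -mulrBl E addrC addKr.
have hs : sin (carg z) = cim z / cabs z.
  rewrite /carg -/(cre z) -/(cim z); case: ifPn => h; rewrite ?sinN sa.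
    by rewrite ger0_norm.
  by rewrite -mulNr ltr0_norm ?opprK // ltNge.
rewrite hc hs; apply: complexP; rewrite ?creM ?cimM creR cimR mul0r ?subr0 ?addr0.
  by rewrite /cre /= mulrC divfK ?gt_eqF.
by rewrite /cim /= mulrC divfK ?gt_eqF.
Qed.

Lemma cpowE z s : z != 0 -> cpow z s = cexp (creal s * clog z).
Proof.
move=> z0; rewrite /cpow /cexp creM cimM creR cimR !mul0r subr0 addr0.
have -> : cre (clog z) = ln (cabs z) by [].
have -> : cim (clog z) = carg z by [].
by rewrite /powR cabs_eq0 (negbTE z0).
Qed.

Lemma cabs_cpow z s : z != 0 -> cabs (cpow z s) = cabs z `^ s.
Proof.
move=> z0; rewrite cpowE // cabs_cexp creM creR cimR mul0r subr0.
by rewrite /powR cabs_eq0 (negbTE z0).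
Qed.

Lemma cpow_neq0 z s : z != 0 -> cpow z s != 0.
Proof. by move=> z0; rewrite -cabs_gt0 cabs_cpow // powR_gt0 // cabs_gt0. Qed.

Lemma cpowS z s : z != 0 -> cpow z (s + 1) = cpow z s * z.
Proof. by move=> z0; rewrite !cpowE // crealD mulrDl cexpD creal1 mul1r cexp_clog. Qed.

Lemma cpow1 s : cpow (1 : C) s = 1.
Proof.
have e : cabs (1 : C) = 1 := cabs1 R.
rewrite /cpow /carg e powR1 /= lexx divr1 acos1 mulr0 cos0 sin0.
by apply: complexP; rewrite /cre /cim /=; ring.
Qed.

(** The two branches of [carg] meet on the positive real axis; the arctangent is differentiable
    across it. *)
Lemma carg_atan z : 0 < cre z -> carg z = atan (cim z / cre z).
Proof.
move=> x0; have zp : 0 < cabs z := lt_le_trans x0 (le_trans (ler_norm _) (ler_cre_cabs z)).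
have hc : cos (atan (cim z / cre z)) = cre z / cabs z.
  rewrite cos_atan; have -> : 1 + (cim z / cre z) ^+ 2 = (cabs z / cre z) ^+ 2.
    by rewrite !exprMn !exprVn cabs_sqr; field; rewrite gt_eqF.
  by rewrite sqrtr_sqr ger0_norm ?invf_div // divr_ge0 // ltW.
have pi0 := pi_gt0 R.
have r1 := atan_gtNpi2 (cim z / cre z); have r2 := atan_ltpi2 (cim z / cre z).
rewrite /carg -/(cre z) -/(cim z); case: (leP 0 (cim z)) => h.
  have a0 : 0 <= atan (cim z / cre z) by have := le_atan (divr_ge0 h (ltW x0)); rewrite atan0.
  by rewrite -hc cosK // in_itv /= a0 /=; lra.
have a0 : atan (cim z / cre z) <= 0.
  have h' : cim z / cre z <= 0 by rewrite pmulr_lle0 ?invr_gt0 // ltW.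
  by have := le_atan h'; rewrite atan0.
by rewrite -hc cosKN ?opprK // a0 andbT; lra.
Qed.

Lemma rdiff_creal_cre z : rdiff (fun w => creal (cre w)) z (creal (1 / 2)) (creal (1 / 2)).
Proof. exact: (rdiff_real (is_derive_id _ _)). Qed.

(** The derivatives are not computed from the formula for the logarithm. It is enough that some [A]
    and [B] exist: the chain rule for [cexp (clog w) = w] and uniqueness then give [z A = 1] and
    [z B = 0]. *)
Lemma rdiff_clog z : 0 < cre z -> rdiff clog z z^-1 0.
Proof.
move=> x0; have zp : 0 < cabs z := lt_le_trans x0 (le_trans (ler_norm _) (ler_cre_cabs z)).
have z0 : z != 0 by rewrite -cabs_gt0.
suff [A [B dL]] : exists A B, rdiff clog z A B.
  have := rdiff_comp dL (rdiff_cexp (clog z)); rewrite !mul0r !addr0 cexp_clog // => dEL.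
  have did : rdiff (fun w => cexp (clog w)) z 1 0.
    apply: (near_rdiff (F := id)) zp _ (rdiff_id z) => w wz; rewrite cexp_clog //.
    by apply: contraTneq wz => ->; rewrite sub0r cabsN ltxx.
  have [hA hB] := rdiff_unique dEL did.
  have -> : z^-1 = A by rewrite -[A](mulKf z0) hA mulr1.
  suff <- : B = 0 by [].
  by apply/eqP; move/eqP: hB; rewrite mulf_eq0 (negbTE z0).
(* The logarithm on the right half-plane as [ln |w|^2 / 2 + i atan (Im w / Re w)], written with
   [cre] around each argument so that [rdiff_real] applies. *)
pose L w := creal (ln (cre (w * cconj w)) / 2) + ci * creal (atan (cre (creal (cim w) * (creal (cre w))^-1))).
have hw w : cabs (w - z) < cre z -> 0 < cre w.
  move=> wz; have := le_lt_trans (ler_cre_cabs _) wz.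
  by rewrite creD creN ltr_norml => /andP[h _]; lra.
suff [A [B dL]] : exists A B, rdiff L z A B.
  exists A, B; apply: (near_rdiff x0 _ dL) => w /hw w0; rewrite /L /clog.
  have wp : 0 < cabs w := lt_le_trans w0 (le_trans (ler_norm _) (ler_cre_cabs w)).
  rewrite mulzJ creR lnXn // carg_atan // -crealV -crealM creR.
  by apply: complexP; rewrite ?creD ?cimD ?creM ?cimM !(creR, cimR) /cre /cim /=; field.
have dm : rdiff (fun w => w * cconj w) z (1 * cconj z + z * 0) (0 * cconj z + z * 1).
  exact: rdiffM (rdiff_id z) (rdiff_conj z).
have m0 : 0 < cre (z * cconj z) by rewrite mulzJ creR exprn_gt0.
have dl := rdiff_comp dm (rdiff_real (is_derive1_ln m0)).
have dl2 := rdiffM dl (rdiff_cst (creal 2^-1) z).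
have dI : rdiff (fun w => creal (cim w)) z (- ci * creal 2^-1) (ci * creal 2^-1).
  have -> : (fun w => creal (cim w)) = (fun w => (w + - 1 * cconj w) * (- ci * creal 2^-1)).
    by apply/funext => w; apply: complexP; rewrite ?creM ?cimM ?creD ?cimD ?creM ?cimM ?creJ ?cimJ /cre /cim /=; field.
  have := rdiffM (rdiffD (rdiff_id z) (rdiffM (rdiff_cst (- 1) z) (rdiff_conj z))) (rdiff_cst (- ci * creal 2^-1) z).
  congr rdiff; ring.
have x0' : creal (cre z) != 0 by rewrite creal_eq0 gt_eqF.
have dH := rdiffM dI (rdiffV x0' (rdiff_creal_cre z)).
have dA := rdiff_comp dH (rdiff_real (is_derive1_atan (cre (creal (cim z) * (creal (cre z))^-1)))).
have := rdiffD dl2 (rdiffM (rdiff_cst ci z) dA).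
set A := (X in rdiff _ _ X _); set B := (X in rdiff _ _ _ X) => dL; exists A, B.
by move: dL; congr rdiff; apply/funext => w; rewrite /L crealM.
Qed.

Lemma rdiff_cpow z s : 0 < cre z -> rdiff (fun w => cpow w s) z (creal s * cpow z s / z) 0.
Proof.
move=> x0; have zp : 0 < cabs z := lt_le_trans x0 (le_trans (ler_norm _) (ler_cre_cabs z)).
have z0 : z != 0 by rewrite -cabs_gt0.
have d1 : rdiff (fun w => creal s * clog w) z (creal s * z^-1) 0.
  by have := rdiffM (rdiff_cst (creal s) z) (rdiff_clog x0); rewrite !mul0r mulr0 !add0r.
have := rdiff_comp d1 (rdiff_cexp _); rewrite !mul0r mulr0 !addr0 -cpowE // => d2.
have -> : creal s * cpow z s / z = cpow z s * (creal s * z^-1) by ring.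
apply: (near_rdiff zp _ d2) => w wz; rewrite -cpowE //.
by apply: contraTneq wz => ->; rewrite sub0r cabsN ltxx.
Qed.

End ComplexPower.

(** * The weight and its truncations *)

Section Cutoff.
Variable R : realType.
Local Notation C := (Cplane R).
Implicit Types (x d p s t : R).

Definition oneBsq (z : C) : R := 1 - cabs z ^+ 2.

Lemma oneBsqE (z : C) : creal (oneBsq z) = 1 + - 1 * (z * cconj z).
Proof. by rewrite mulzJ /oneBsq crealD crealN creal1; ring. Qed.

Lemma oneBsq_gt0 (z : C) : (0 < oneBsq z) = (cabs z < 1).
Proof. by rewrite subr_gt0 expr_lt1 // cabs_ge0. Qed.

Lemma oneBsq_le1 (z : C) : oneBsq z <= 1.
Proof. by rewrite /oneBsq gerBl sqr_ge0. Qed.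

Lemma rdiff_radial (f : R -> R) (z : C) (f' : R) : is_derive (oneBsq z) (1 : R) f f' ->
  rdiff (fun w => creal (f (oneBsq w))) z (- creal f' * cconj z) (- creal f' * z).
Proof.
move=> df.
have dS : rdiff (fun w => creal (oneBsq w)) z (- cconj z) (- z).
  have -> : (fun w : C => creal (oneBsq w)) = (fun w => 1 + - 1 * (w * cconj w)).
    by apply/funext => w; exact: oneBsqE.
  have := rdiffD (rdiff_cst 1 z) (rdiffM (rdiff_cst (- 1) z) (rdiffM (rdiff_id z) (rdiff_conj z))).
  by congr rdiff; ring.
have df' : is_derive (cre (creal (oneBsq z))) (1 : R) f f' by [].
have := rdiff_comp dS (rdiff_real df').
have -> : creal f' = creal (f' / 2) + creal (f' / 2) by rewrite -crealD -splitr.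
rewrite !cconjN cconjK; congr rdiff; ring.
Qed.

Lemma continuous_oneBsq (z : C) : {for z, continuous oneBsq}.
Proof.
have := rdiff_continuous (rdiff_radial (f := id) (z := z) (is_derive_id _ _)).
move=> /continuousCP H; apply/continuousRP => e /H[d d0 Hd]; exists d => // w /Hd.
by rewrite -crealN -crealD cabsR.
Qed.

Definition ramp d s := Num.max (s - d) 0.

Lemma ramp_ge0 d s : 0 <= ramp d s.
Proof. by rewrite /ramp le_max lexx orbT. Qed.

Lemma ramp_le d s : 0 <= d -> 0 <= s -> ramp d s <= s.
Proof. by move=> d0 s0; rewrite /ramp ge_max s0 andbT gerBl. Qed.

Lemma ramp0 d s : s <= d -> ramp d s = 0.
Proof. by move=> sd; rewrite /ramp; apply/max_idPr; rewrite subr_le0. Qed.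

(** Squaring removes the corner of the positive part: the first order remainder is at most
    [(z - x)^2] in all four sign cases. *)
Lemma is_derive_ramp2 d x : is_derive x (1 : R) (fun t => ramp d t ^+ 2) (2 * ramp d x).
Proof.
have key z : `|ramp d z ^+ 2 - ramp d x ^+ 2 - 2 * ramp d x * (z - x)| <= (z - x) ^+ 2.
  have -> : z - x = (z - d) - (x - d) by ring.
  rewrite /ramp; move: (z - d) (x - d) => u v.
  have q1 := sqr_ge0 (u - v); have q2 := sqr_ge0 u; have q3 := sqr_ge0 v.
  have [u0|u0] := leP u 0; have [v0|v0] := leP v 0; rewrite ler_norml; apply/andP.
  - by split; lra.
  - have /mulr_ge0/(_ (ltW v0)) uv : 0 <= - u by lra.
    by split; nra.
  - have uv : 0 <= u * - v by rewrite mulr_ge0 ?oppr_ge0 // ltW.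
    by split; nra.
  - by split; nra.
apply/is_derive1_caratheodory.
exists (fun z => if z == x then 2 * ramp d x else (ramp d z ^+ 2 - ramp d x ^+ 2) / (z - x)).
split.
- move=> z; case: eqVneq => [->|zx]; first by rewrite !subrr mulr0.
  by rewrite divfK // subr_eq0.
- apply/cvgrPdist_le => e e0; apply/nbhs_ballP; exists e => // z zx'.
  have {}zx' : `|x - z| < e := zx'.
  rewrite eqxx; case: eqVneq => [_|zx]; first by rewrite subrr normr0 ltW.
  have zx0 : z - x != 0 by rewrite subr_eq0.
  rewrite distrC; apply: le_trans (ltW zx'); rewrite [leRHS]distrC.
  have zp : 0 < `|z - x| by rewrite normr_gt0.
  rewrite -(ler_pM2r zp) -!normrM mulrBl divfK //.
  by apply: le_trans (key z) _; rewrite expr2 ler_norm.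
- by rewrite eqxx.
Qed.

Lemma continuous_ramp d x : {for x, continuous (ramp d)}.
Proof.
apply/cvgrPdist_le => e e0; apply/nbhs_ballP; exists e => // z zx.
have {}zx : `|x - z| < e := zx.
apply: le_trans (ltW zx); rewrite /ramp /Num.max.
case: ltP => h1; case: ltP => h2; rewrite ?subrr ?normr0 //.
- by rewrite !ler_norml; apply/andP; have := ler_norm (x - z); have := ler_norm (z - x);
  rewrite (distrC z x); split; lra.
- by rewrite !ler_norml; apply/andP; have := ler_norm (x - z); have := ler_norm (z - x);
  rewrite (distrC z x); split; lra.
- by have -> : x - d - (z - d) = x - z by ring.
Qed.

(* A C^1 truncation of s^p near s = 0, where the derivative of s^p may be unbounded. *)
Definition tpow d p s := ramp d s ^+ 2 * s `^ (p - 2).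
Definition dtpow d p s :=
  2 * ramp d s * s `^ (p - 2) + ramp d s ^+ 2 * ((p - 2) * s `^ (p - 3)).

Lemma powRSl p s : 0 < s -> s `^ p = s * s `^ (p - 1).
Proof.
move=> s0; have : s `^ (1 + (p - 1)) = s `^ 1 * s `^ (p - 1).
  by rewrite (powRD (r := 1)) //; apply/implyP => _; rewrite gt_eqF.
by rewrite addrC subrK powRr1 // ltW.
Qed.

Lemma powR_split2 p s : 0 < s -> s `^ p = s ^+ 2 * s `^ (p - 2).
Proof.
move=> s0; rewrite powRSl // (powRSl (p - 1)) // mulrA -expr2; congr (_ * _ `^ _); ring.
Qed.

Lemma tpow_ge0 d p s : 0 <= tpow d p s.
Proof. by rewrite /tpow mulr_ge0 ?sqr_ge0 ?powR_ge0. Qed.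

Lemma tpow_le d p s : 0 <= d -> 0 < s -> tpow d p s <= s `^ p.
Proof.
move=> d0 s0; rewrite (powR_split2 p s0) ler_wpM2r ?powR_ge0 //.
by rewrite ler_pXn2r ?nnegrE ?ramp_ge0 ?(ltW s0) // ramp_le // ltW.
Qed.

Lemma dtpowE d p s : 0 < s ->
  dtpow d p s = ramp d s * (2 * s + (p - 2) * ramp d s) * s `^ (p - 3).
Proof.
move=> s0; rewrite /dtpow (powRSl (p - 2) s0).
have -> : p - 2 - 1 = p - 3 by ring.
by ring.
Qed.

(** As [ramp d s <= s], the factor [2 s + (p - 2) ramp d s] is at least [p ramp d s], even for
    [p < 2]. *)
Lemma dtpow_ge0 d p s : 0 <= d -> 0 <= p -> 0 < s -> 0 <= dtpow d p s.
Proof.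
move=> d0 p0 s0; rewrite dtpowE //; apply: mulr_ge0; last exact: powR_ge0.
apply: mulr_ge0; first exact: ramp_ge0.
have := ramp_le d0 (ltW s0); have := mulr_ge0 p0 (ramp_ge0 d s); lra.
Qed.

(** The constant is independent of [d], so the right side dominates all truncations at once. *)
Lemma dtpow_le d p s : 0 <= d -> 0 <= p -> 0 < s -> dtpow d p s <= (2 + p) * s `^ (p - 1).
Proof.
move=> d0 p0 s0; rewrite dtpowE // (powR_split2 (p - 1)) //.
have -> : p - 1 - 2 = p - 3 by ring.
rewrite mulrA ler_wpM2r ?powR_ge0 //.
have r0 := ramp_ge0 d s; have rs := ramp_le d0 (ltW s0).
set r := ramp d s in r0 rs *.
have h1 : r * s <= s ^+ 2 by rewrite expr2 ler_wpM2r // ltW.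
have h2 : r ^+ 2 <= s ^+ 2 by rewrite ler_pXn2r ?nnegrE // ltW.
have h3 : p * r ^+ 2 <= p * s ^+ 2 by rewrite ler_wpM2l.
have h4 := sqr_ge0 r.
have -> : r * (2 * s + (p - 2) * r) = 2 * (r * s) + p * r ^+ 2 - 2 * r ^+ 2 by ring.
lra.
Qed.

Lemma tpow0 d p s : s <= d -> tpow d p s = 0.
Proof. by move=> sd; rewrite /tpow ramp0 // expr0n mul0r. Qed.

Lemma dtpow0 d p s : s <= d -> dtpow d p s = 0.
Proof. by move=> sd; rewrite /dtpow ramp0 // expr0n !(mulr0, mul0r) addr0. Qed.

Lemma rdiff_tpow d p (z : C) : cabs z < 1 ->
  exists A, rdiff (fun w => creal (tpow d p (oneBsq w))) z A (- creal (dtpow d p (oneBsq z)) * z).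
Proof.
rewrite -oneBsq_gt0 => s0.
have dp : is_derive (oneBsq z) (1 : R) (fun t => t `^ (p - 2)) ((p - 2) * oneBsq z `^ (p - 3)).
  have -> : p - 3 = p - 2 - 1 by ring.
  exact: is_derive1_powR.
have := rdiffM (rdiff_radial (is_derive_ramp2 d _)) (rdiff_radial dp).
have -> : (fun w : C => creal (ramp d (oneBsq w) ^+ 2) * creal (oneBsq w `^ (p - 2))) =
    (fun w => creal (tpow d p (oneBsq w))).
  by apply/funext => w; rewrite -crealM.
set A := (X in rdiff _ _ X _); move=> dG; exists A; move: dG; congr rdiff.
by rewrite /dtpow !crealD !crealM; ring.
Qed.

Lemma continuous_powR p s : 0 < s -> {for s, continuous (fun t => t `^ p)}.
Proof.
move=> s0; apply: differentiable_continuous; apply/derivable1_diffP.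
have h : is_derive s (1 : R) (fun t => t `^ p) (p * s `^ (p - 1)) by exact: is_derive1_powR.
exact: ex_derive.
Qed.

Lemma continuous_dtpow d p (z : C) : cabs z < 1 ->
  {for z, continuous (fun w => creal (dtpow d p (oneBsq w)))}.
Proof.
rewrite -oneBsq_gt0 => s0; apply: continuous_creal.
apply: (continuous_comp (continuous_oneBsq (z := z)) (g := dtpow d p)).
have cr := continuous_ramp (d := d) (x := oneBsq z).
have c2 := continuous_powR (p := p - 2) s0; have c3 := continuous_powR (p := p - 3) s0.
apply: cvgD.
  apply: cvgM; last exact: c2.
  by apply: cvgM; [exact: cvg_cst|exact: cr].
apply: cvgM; last by apply: cvgM; [exact: cvg_cst|exact: c3].
by rewrite /= expr2; apply: cvgM; exact: cr.
Qed.

End Cutoff.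

(** * Integrals over the disk and Green's formula for truncated weights *)

Section DiskIntegral.
Variable R : realType.
Local Notation C := (Cplane R).
Local Notation leb2 := (@lebesgue_measure R \x @lebesgue_measure R)%E.
Local Notation plane := (measurableTypeR R * measurableTypeR R)%type.
Local Notation D2 := (disk2 (R := R) : set plane).
Implicit Types (d p s M : R) (Q K F : C -> C).

Lemma disk2_fin : (leb2 D2 < +oo)%E.
Proof.
apply: le_lt_trans (square_fin (-1) (-1) (2 : R)).
apply: le_measure; rewrite ?inE; [exact: measurable_disk2|exact: measurable_square|].
exact: disk2_sub_square.
Qed.

Lemma square_sub_disk2 : square 0 0 (2^-1 : R) `<=` D2.
Proof.
move=> [s t] [/=]; rewrite !in_itv /= !add0r => /andP[s0 s1] /andP[t0 t1].
have -> : D2 (s, t) = (cabs (pt (s, t)) < 1) by [].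
rewrite -(ltr_pXn2r (n := 2)) ?nnegrE ?cabs_ge0 // cabs_sqr cre_pt cim_pt /= expr1n.
by nra.
Qed.

Lemma disk2_gt0 : 0 < fine (leb2 D2).
Proof.
have h : (leb2 (square 0 0 (2^-1 : R)) <= leb2 D2)%E.
  apply: le_measure; rewrite ?inE; [exact: measurable_square|exact: measurable_disk2|].
  exact: square_sub_disk2.
have : fine (leb2 (square 0 0 (2^-1 : R))) <= fine (leb2 D2).
  by apply: fine_le => //; rewrite ge0_fin_numE //; [exact: square_fin|exact: disk2_fin].
by apply: lt_le_trans; rewrite fine_square.
Qed.

Lemma measurable_on_disk (f : C -> R) : (forall z, disk z -> {for z, continuous f}) ->
  measurable_fun D2 (f \o @pt R).
Proof. by move=> cf; apply: (measurable_continuous_pt (@nbhs_disk R) cf). Qed.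

Lemma integrable_on_disk (f : C -> R) (g : C -> R) :
  (forall z, disk z -> {for z, continuous f}) ->
  (forall z, disk z -> `|f z| <= g z) -> leb2.-integrable D2 (EFin \o (g \o @pt R)) ->
  leb2.-integrable D2 (EFin \o (f \o @pt R)).
Proof.
move=> cf fg; apply: le_integrable; first exact: measurable_disk2.
- by apply/measurable_EFinP; exact: measurable_on_disk.
- by move=> q Dq /=; rewrite lee_fin; apply: le_trans (ler_norm _); exact: fg.
Qed.

Lemma integrable_cst_disk M : leb2.-integrable D2 (EFin \o ((fun=> M) \o @pt R)).
Proof.
apply: measurable_bounded_integrable.
- exact: measurable_disk2.
- exact: disk2_fin.
- exact: measurable_cst.
- exact: bounded_cst.
Qed.

(** The power is monotone in one sense or the other according to the sign of [p]; the sum covers the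
    values at both ends. *)
Lemma powR_le_max d p s : 0 < d -> d <= s -> s <= 1 -> s `^ p <= 1 + d `^ p.
Proof.
move=> d0 ds s1; have s0 := lt_le_trans d0 ds.
have [p0|p0] := leP 0 p.
  have := ge0_ler_powR p0 (x := s) (y := 1); rewrite !nnegrE powR1 ler01 => h.
  by apply: le_trans (h (ltW s0) isT s1) _; rewrite lerDl powR_ge0.
have np0 : 0 <= - p by rewrite oppr_ge0 ltW.
rewrite -[p]opprK powRN [d `^ _]powRN.
have h : d `^ (- p) <= s `^ (- p) by apply: ge0_ler_powR; rewrite ?nnegrE // ltW.
apply: (@le_trans _ _ (d `^ (- p))^-1); last by rewrite lerDr.
by rewrite lef_pV2 ?posrE ?powR_gt0.
Qed.

Lemma powR_lep p s : 0 <= p -> 0 < s -> s <= 1 -> s `^ p <= s `^ (p - 1).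
Proof. by move=> p0 s0 s1; rewrite powRSl // ler_piMl // powR_ge0. Qed.

(** The integrand is the conjugate derivative of [Q K] times the truncated weight, as [Q]
    contributes none and [oneBsq] contributes [- w]. [Q] and [K] are controlled on the disk only,
    but the truncation vanishes near every point outside it, so the product extends by 0. *)
Lemma green_weight d p (xi : C) Q K (K' : C -> C) M : 0 < d -> 0 < p ->
  (forall z, disk z -> {for z, continuous Q}) ->
  (forall z, disk z -> z != xi -> exists A, rdiff Q z A 0) ->
  (forall z, disk z -> exists A, rdiff K z A (K' z)) ->
  (forall z, disk z -> {for z, continuous K'}) ->
  (forall z, disk z -> [/\ cabs (Q z) <= M, cabs (K z) <= M & cabs (K' z) <= M]) ->
  \int[leb2]_(q in D2) cre (Q (pt q) * (K' (pt q) * creal (tpow d p (oneBsq (pt q))) -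
     K (pt q) * pt q * creal (dtpow d p (oneBsq (pt q))))) = 0.
Proof.
move=> d0 p0 cQ dQ dK cK' bnd.
pose T w : C := creal (tpow d p (oneBsq w)).
pose T' w : C := creal (dtpow d p (oneBsq w)).
pose G w := Q w * (K w * T w).
pose D w := Q w * (K' w * T w - K w * w * T' w).
have zero w : oneBsq w <= d -> T w = 0 /\ T' w = 0.
  by move=> wd; rewrite /T /T' tpow0 // dtpow0 // creal0.
have G0 w : oneBsq w <= d -> G w = 0.
  by move=> /zero[t0 t0']; rewrite /G t0 !mulr0.
have D0 w : oneBsq w <= d -> D w = 0.
  by move=> /zero[t0 t0']; rewrite /D t0 t0' !mulr0 subrr mulr0.
have out w : 1 <= cabs w -> oneBsq w <= d.
  move=> w1; apply: le_trans (ltW d0); rewrite leNgt oneBsq_gt0.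
  by rewrite -leNgt.
have dT z : disk z -> exists A, rdiff T z A (- T' z * z) by exact: rdiff_tpow.
have cT z : disk z -> {for z, continuous T}.
  by move=> /dT[A]; exact: rdiff_continuous.
have cT' z : disk z -> {for z, continuous T'} by exact: continuous_dtpow.
have cK z : disk z -> {for z, continuous K} by move=> /dK[A]; exact: rdiff_continuous.
have loc (z : C) : disk z \/ exists2 r : R, 0 < r & forall w, cabs (w - z) < r -> oneBsq w <= d.
  have [z1|z1] := ltP (cabs z) 1; [by left|right].
  have := continuous_oneBsq (z := z) => /continuousRP/(_ d d0)[r r0 Hr].
  exists r => // w /Hr; have : oneBsq z <= 0 by rewrite leNgt oneBsq_gt0 -leNgt.
  by rewrite ltr_norml => h /andP[_]; lra.
have cG z : {for z, continuous G}.
  have [zd|[r r0 Hr]] := loc z.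
    exact: continuousM_C (cQ _ zd) (continuousM_C (cK _ zd) (cT _ zd)).
  apply: (near_continuous r0 (F := fun=> 0)) => [w wz|]; last exact: continuous_cst_C.
  by rewrite G0 // Hr.
have cD z : {for z, continuous D}.
  have [zd|[r r0 Hr]] := loc z.
    apply: continuousM_C (cQ _ zd) (continuousD_C (continuousM_C (cK' _ zd) (cT _ zd)) _).
    apply: continuousN_C; apply: continuousM_C (cT' _ zd).
    exact: continuousM_C (cK _ zd) (continuous_id_C (z := z)).
  apply: (near_continuous r0 (F := fun=> 0)) => [w wz|]; last exact: continuous_cst_C.
  by rewrite D0 // Hr.
have dG z : z != xi -> exists A, rdiff G z A (D z).
  move=> zxi; have [zd|[r r0 Hr]] := loc z; last first.
    exists 0; rewrite D0; last by apply: Hr; rewrite subrr cabs0.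
    by apply: (near_rdiff r0 _ (rdiff_cst 0 z)) => w wz; rewrite G0 // Hr.
  have [A dA] := dQ _ zd zxi; have [B dB] := dK _ zd; have [E dE] := dT _ zd.
  have := rdiffM dA (rdiffM dB dE); set A' := (X in rdiff _ _ X _) => dG.
  by exists A'; move: dG; congr rdiff; rewrite /D; ring.
have M0 : 0 <= M.
  have d0' : disk (0 : C) by change (is_true (cabs (0 : C) < 1)); rewrite cabs0.
  by have [h _ _] := bnd 0 d0'; exact: le_trans (cabs_ge0 _) h.
(* Bound for the derivative of the truncation where [oneBsq z > d], from [dtpow_le] and
   [powR_le_max] with exponent [p - 1]. *)
pose N := (2 + p) * (1 + d `^ (p - 1)).
have N0 : 0 <= N by rewrite mulr_ge0 ?addr_ge0 ?powR_ge0 ?ltW.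
have bD z : cabs (D z) <= M * (M * 1 + M * 1 * N).
  have [zd|zd] := leP (oneBsq z) d.
    by rewrite D0 // cabs0 !mulr1; apply: mulr_ge0 => //; apply: addr_ge0 => //; exact: mulr_ge0.
  have s0 := lt_trans d0 zd; have z1 : disk z by change (is_true (cabs z < 1)); rewrite -oneBsq_gt0.
  have [bQ bK bK'] := bnd z z1.
  have bT : cabs (T z) <= 1.
    rewrite /T cabsR ger0_norm ?tpow_ge0 //; apply: le_trans (tpow_le _ (ltW d0) s0) _.
    have := ge0_ler_powR (ltW p0) (x := oneBsq z) (y := 1).
    by rewrite !nnegrE powR1 ler01 => h; apply: h => //; [exact: ltW|exact: oneBsq_le1].
  have bT' : cabs (T' z) <= N.
    rewrite /T' cabsR ger0_norm ?dtpow_ge0 ?(ltW d0) ?(ltW p0) //.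
    apply: le_trans (dtpow_le (ltW d0) (ltW p0) s0) _.
    rewrite ler_wpM2l ?addr_ge0 ?(ltW p0) //; apply: powR_le_max => //; first exact: ltW.
    exact: oneBsq_le1.
  rewrite cabsM; apply: ler_pM; rewrite ?cabs_ge0 //.
  apply: le_trans (cabsD _ _) _; rewrite cabsN !cabsM; apply: lerD.
    by apply: ler_pM; rewrite ?cabs_ge0.
  apply: ler_pM; rewrite ?mulr_ge0 ?cabs_ge0 //.
  by apply: ler_pM; rewrite ?cabs_ge0 // ltW.
by apply: (green (G := G) (D := D) cG cD bD dG) => w /out; [exact: G0|exact: D0].
Qed.

Lemma cvg_ramp s : 0 <= s -> (fun n => ramp n.+1%:R^-1 s) @ \oo --> s.
Proof.
move=> s0.
have key h : 0 <= h -> `|s - ramp h s| <= h.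
  move=> h0; have h1 := ramp_le h0 s0.
  have h2 : s - h <= ramp h s by rewrite /ramp le_max lexx.
  by rewrite ler_norml; apply/andP; split; lra.
apply/cvgrPdist_le => e e0.
have := cvg_harmonic (R := R) => /cvgrPdist_le/(_ e e0); apply: filterS => n /=.
have h0 : 0 <= (n.+1%:R^-1 : R) by rewrite invr_ge0.
by rewrite sub0r normrN ger0_norm //; apply: le_trans; exact: key.
Qed.

Lemma cvg_tpow p s : 0 < s -> (fun n => tpow n.+1%:R^-1 p s) @ \oo --> s `^ p.
Proof.
move=> s0; rewrite (powR_split2 p s0); apply: cvgM; last exact: cvg_cst.
have h := cvg_ramp (ltW s0); rewrite expr2; under eq_fun do rewrite expr2.
exact: cvgM.
Qed.

Lemma cvg_dtpow p s : 0 < s -> (fun n => dtpow n.+1%:R^-1 p s) @ \oo --> p * s `^ (p - 1).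
Proof.
move=> s0; have h := cvg_ramp (ltW s0).
have -> : p * s `^ (p - 1) = 2 * s * s `^ (p - 2) + s * s * ((p - 2) * s `^ (p - 3)).
  have -> : p - 3 = p - 2 - 1 by ring.
  have -> : s `^ (p - 1) = s * s `^ (p - 2).
    by rewrite (powRSl (p - 1)) //; congr (_ * _ `^ _); ring.
  by rewrite (powRSl (p - 2)) //; ring.
rewrite /dtpow; under eq_fun do rewrite expr2.
apply: cvgD; apply: cvgM; try exact: cvg_cst.
- by apply: cvgM => //; exact: cvg_cst.
- exact: cvgM.
Qed.

End DiskIntegral.

Arguments disk2_fin {R}.
Arguments integrable_cst_disk {R}.

(** * Integrability of the weight and removal of the truncation *)

Section WeightedGreen.
Variable R : realType.
Local Notation C := (Cplane R).
Local Notation leb2 := (@lebesgue_measure R \x @lebesgue_measure R)%E.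
Local Notation plane := (measurableTypeR R * measurableTypeR R)%type.
Local Notation D2 := (disk2 (R := R) : set plane).
Implicit Types (p M : R) (Q K F : C -> C).

Lemma continuousM_R (f g : C -> R) (z : C) : {for z, continuous f} ->
  {for z, continuous g} -> {for z, continuous (fun w => f w * g w)}.
Proof. by move=> cf cg; exact: cvgM cf cg. Qed.

Lemma continuousZ_R (k : R) (g : C -> R) (z : C) : {for z, continuous g} ->
  {for z, continuous (fun w => k * g w)}.
Proof. by move=> cg; exact: cvgM (cvg_cst _) cg. Qed.

Lemma continuous_cabs_sqr (z : C) : {for z, continuous (fun w : C => cabs w ^+ 2)}.
Proof.
have h := continuous_oneBsq (z := z).
apply/continuousRP => e /(proj1 (continuousRP _ _) h)[d d0 Hd]; exists d => // w /Hd.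
by rewrite /oneBsq distrC opprB addrC addrA subrK.
Qed.

Lemma continuous_of_creal (f : C -> R) (z : C) :
  {for z, continuous (fun w => creal (f w))} -> {for z, continuous f}.
Proof. by move=> h; exact: (continuous_comp h (continuous_cre (z := _))). Qed.

Lemma continuous_tpow d p (z : C) : disk z ->
  {for z, continuous (fun w => tpow d p (oneBsq w))}.
Proof.
by move=> /(rdiff_tpow d p)[A dA]; apply: continuous_of_creal; exact: (rdiff_continuous dA).
Qed.

Lemma continuous_weight p (z : C) : disk z ->
  {for z, continuous (fun w : C => oneBsq w `^ p)}.
Proof.
move=> z1; have s0 : 0 < oneBsq z by rewrite oneBsq_gt0.
exact: (continuous_comp (continuous_oneBsq (z := z)) (continuous_powR (p := p) s0)).
Qed.

Lemma integrable_cabs_weight p : 0 < p ->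
  leb2.-integrable D2 (EFin \o ((fun w => cabs w ^+ 2 * (p * oneBsq w `^ (p - 1))) \o @pt R)).
Proof.
move=> p0; pose f n (q : plane) := cabs (pt q) ^+ 2 * dtpow n.+1%:R^-1 p (oneBsq (pt q)).
have n0 n : 0 < n.+1%:R^-1 :> R by rewrite invr_gt0.
have s0 (q : plane) : D2 q -> 0 < oneBsq (pt q) by rewrite oneBsq_gt0.
have cf n z : disk z -> {for z, continuous (fun w => cabs w ^+ 2 * dtpow n.+1%:R^-1 p (oneBsq w))}.
  move=> zd; apply: continuousM_R (continuous_cabs_sqr (z := z)) _.
  exact/continuous_of_creal/continuous_dtpow.
have ct n z : disk z -> {for z, continuous (fun w => tpow n.+1%:R^-1 p (oneBsq w))}.
  exact: continuous_tpow.
have t1 n (z : C) : disk z -> `|tpow n.+1%:R^-1 p (oneBsq z)| <= 1.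
  move=> zd; have sz : 0 < oneBsq z by rewrite oneBsq_gt0.
  rewrite ger0_norm ?tpow_ge0 //; apply: le_trans (tpow_le _ (ltW (n0 n)) sz) _.
  have := ge0_ler_powR (ltW p0) (x := oneBsq z) (y := 1).
  by rewrite !nnegrE powR1 ler01 => h; apply: h => //; [exact: ltW|exact: oneBsq_le1].
have it n : leb2.-integrable D2 (EFin \o ((fun w => tpow n.+1%:R^-1 p (oneBsq w)) \o @pt R)).
  exact: (integrable_on_disk (ct n) (t1 n) (integrable_cst_disk 1)).
(* This bound may blow up with [n]; it serves only the integrability of each [f n]. The uniform
   bound is [If]. *)
pose B n := (2 + p) * (1 + n.+1%:R^-1 `^ (p - 1)) : R.
have fB n (z : C) : disk z -> `|cabs z ^+ 2 * dtpow n.+1%:R^-1 p (oneBsq z)| <= B n.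
  move=> zd; have sz : 0 < oneBsq z by rewrite oneBsq_gt0.
  have [h|h] := leP (oneBsq z) n.+1%:R^-1.
    by rewrite dtpow0 // mulr0 normr0 mulr_ge0 ?addr_ge0 ?powR_ge0 ?ltW.
  have d0 := dtpow_ge0 (ltW (n0 n)) (ltW p0) sz.
  rewrite normrM (ger0_norm d0) ger0_norm ?sqr_ge0 //.
  have z1 : cabs z ^+ 2 <= 1 by rewrite -subr_ge0 ltW.
  apply: le_trans (ler_piMl d0 z1) _.
  apply: le_trans (dtpow_le (ltW (n0 n)) (ltW p0) sz) _.
  rewrite ler_wpM2l ?addr_ge0 ?(ltW p0) //; apply: powR_le_max => //; first exact: ltW.
  exact: oneBsq_le1.
have if_ n : leb2.-integrable D2 (EFin \o f n).
  exact: (integrable_on_disk (cf n) (fB n) (integrable_cst_disk (B n))).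
have If n : (\int[leb2]_(q in D2) (f n q)%:E <= leb2 D2)%E.
  (* With [Q = 1] and [K = conj w], Green's formula equates the integral of [f n] with that of the
     truncated power, which is at most 1 pointwise. *)
  have := green_weight (d := n.+1%:R^-1) (p := p) (xi := 0) (Q := fun=> 1)
    (K := @cconj R) (K' := fun=> 1) (M := 1) (n0 n) p0.
  have -> : \int[leb2]_(q in D2) cre (1 * (1 * creal (tpow n.+1%:R^-1 p (oneBsq (pt q))) -
     cconj (pt q) * pt q * creal (dtpow n.+1%:R^-1 p (oneBsq (pt q))))) =
     \int[leb2]_(q in D2) (tpow n.+1%:R^-1 p (oneBsq (pt q)) - f n q).
    apply: eq_Rintegral => q _; rewrite !mul1r creD creN creR /f.
    by rewrite [cconj _ * _]mulrC mulzJ -crealM creR.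
  rewrite RintegralB //; [|exact: measurable_disk2|exact: it].
  move=> E; have {E} : \int[leb2]_(q in D2) tpow n.+1%:R^-1 p (oneBsq (pt q)) -
      \int[leb2]_(q in D2) f n q = 0.
    apply: E.
    - by move=> z _; exact: continuous_cst_C.
    - by move=> z _ _; exists 0; exact: rdiff_cst.
    - by move=> z _; exists 0; exact: rdiff_conj.
    - by move=> z _; exact: continuous_cst_C.
    - by move=> z zd; rewrite cabsJ cabs1; split=> //; exact: ltW.
  move=> /eqP; rewrite subr_eq0 => /eqP E.
  have -> : (\int[leb2]_(q in D2) (f n q)%:E)%E = (\int[leb2]_(q in D2) f n q)%:E.
    by rewrite /Rintegral fineK //; exact: (integrable_fin_num measurable_disk2 (if_ n)).
  rewrite -E -[leRHS]fineK; last by rewrite ge0_fin_numE //; exact: disk2_fin.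
  rewrite lee_fin -[leRHS]mul1r -(Rintegral_cst leb2 measurable_disk2 1).
  apply: le_Rintegral => //; [exact: measurable_disk2|exact: it|exact: integrable_cst_disk|].
  by move=> q Dq; apply: le_trans (ler_norm _) (t1 n _ Dq).
have mf n : measurable_fun D2 (fun q => (f n q)%:E).
  by apply/measurable_EFinP; exact: measurable_on_disk (cf n).
have f0 n q : D2 q -> (0 <= (f n q)%:E)%E.
  move=> Dq; rewrite lee_fin mulr_ge0 ?sqr_ge0 //.
  by apply: dtpow_ge0; rewrite ?(ltW (n0 n)) ?(ltW p0) // s0.
apply/integrableP; split.
  apply/measurable_EFinP; apply: (measurable_on_disk (f := fun w => cabs w ^+ 2 * (p * oneBsq w `^ (p - 1)))).
  move=> z zd; apply: continuousM_R (continuous_cabs_sqr (z := z)) _.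
  exact: continuousZ_R (continuous_weight zd).
apply: le_lt_trans disk2_fin.
have := fatou leb2 measurable_disk2 mf f0.
have -> : (\int[leb2]_(x in D2) limn_einf (fun n => (f n x)%:E) =
  \int[leb2]_(x in D2) `|(EFin \o ((fun w => (cabs w ^+ 2 * (p * oneBsq w `^ (p - 1)))%R) \o @pt R)) x|)%E.
  apply: eq_integral => q /set_mem Dq /=.
  have cv : (fun n => (f n q)%:E) @ \oo --> (cabs (pt q) ^+ 2 * (p * oneBsq (pt q) `^ (p - 1)))%:E.
    apply: cvg_EFin; first exact: nearW.
    apply: cvgM; first exact: cvg_cst.
    by apply: cvg_dtpow; exact: s0.
  rewrite is_cvg_limn_einfE; last by apply/cvg_ex; eexists; exact: cv.
  rewrite (cvg_lim _ cv) // ger0_norm //.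
  by apply: mulr_ge0; [exact: sqr_ge0|apply: mulr_ge0; [exact: ltW|exact: powR_ge0]].
move=> h; apply: le_trans h _; rewrite limn_einf_lim; apply: lime_le.
  exact: is_cvg_einfs.
apply: nearW => n; apply: le_trans (If n).
by apply: ereal_inf_lbound; exists n => /=.
Qed.

(** Since [1 = s + |w|^2], one has [s^(p-1) = s^p + |w|^2 s^(p-1)]: the first term is at most 1 and
    the second was just shown to be integrable. *)
Lemma integrable_weight p : 0 < p ->
  leb2.-integrable D2 (EFin \o ((fun w => oneBsq w `^ (p - 1)) \o @pt R)).
Proof.
move=> p0; have h := integrable_cabs_weight p0.
have iZ : leb2.-integrable D2 (EFin \o ((fun w => p^-1 * (cabs w ^+ 2 * (p * oneBsq w `^ (p - 1)))) \o @pt R)).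
  by apply: (eq_integrable measurable_disk2 _ _ _ (integrableZl measurable_disk2 p^-1 h)) => q _.
have iD := integrableD measurable_disk2 (integrable_cst_disk 1) iZ.
apply: (integrable_on_disk (g := fun w => 1 + p^-1 * (cabs w ^+ 2 * (p * oneBsq w `^ (p - 1))))).
- by move=> z zd; exact: continuous_weight.
- move=> z zd; have sz : 0 < oneBsq z by rewrite oneBsq_gt0.
  rewrite ger0_norm ?powR_ge0 //.
  have E : oneBsq z `^ (p - 1) = oneBsq z `^ p + cabs z ^+ 2 * oneBsq z `^ (p - 1).
    by rewrite (powRSl p sz) /oneBsq; ring.
  rewrite {1}E; apply: lerD.
    have := ge0_ler_powR (ltW p0) (x := oneBsq z) (y := 1).
    by rewrite !nnegrE powR1 ler01 => h'; apply: h' => //; [exact: ltW|exact: oneBsq_le1].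
  by rewrite mulrCA [p^-1 * _]mulrA mulVf ?mul1r // gt_eqF.
- by apply: (eq_integrable measurable_disk2 _ _ _ iD) => q _.
Qed.

Lemma weighted_green p (xi : C) Q K (K' : C -> C) M : 0 < p ->
  (forall z, disk z -> {for z, continuous Q}) ->
  (forall z, disk z -> z != xi -> exists A, rdiff Q z A 0) ->
  (forall z, disk z -> exists A, rdiff K z A (K' z)) ->
  (forall z, disk z -> {for z, continuous K'}) ->
  (forall z, disk z -> [/\ cabs (Q z) <= M, cabs (K z) <= M & cabs (K' z) <= M]) ->
  \int[leb2]_(q in D2) cre (Q (pt q) * (K' (pt q) * creal (oneBsq (pt q) `^ p) -
     K (pt q) * pt q * creal (p * oneBsq (pt q) `^ (p - 1)))) = 0.
Proof.
move=> p0 cQ dQ dK cK' bnd.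
pose H (w : C) (a b : R) := cre (Q w * (K' w * creal a - K w * w * creal b)).
have HE w a b : H w a b = cre (Q w * K' w) * a - cre (Q w * K w * w) * b.
  rewrite /H; have -> : Q w * (K' w * creal a - K w * w * creal b) =
    Q w * K' w * creal a - Q w * K w * w * creal b by ring.
  by rewrite creD creN !creM !creR !cimR; ring.
have n0 n : 0 < n.+1%:R^-1 :> R by rewrite invr_gt0.
have cK z : disk z -> {for z, continuous K} by move=> /dK[A]; exact: rdiff_continuous.
pose f n (q : plane) := H (pt q) (tpow n.+1%:R^-1 p (oneBsq (pt q)))
  (dtpow n.+1%:R^-1 p (oneBsq (pt q))).
pose F (q : plane) := H (pt q) (oneBsq (pt q) `^ p) (p * oneBsq (pt q) `^ (p - 1)).
have cH (z : C) (a b : C -> R) : disk z -> {for z, continuous (fun w => creal (a w))} ->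
    {for z, continuous (fun w => creal (b w))} ->
    {for z, continuous (fun w => H w (a w) (b w))}.
  move=> zd ca cb.
  have cc : {for z, continuous (fun w => Q w * (K' w * creal (a w) - K w * w * creal (b w)))}.
    apply: continuousM_C (cQ _ zd) (continuousD_C (continuousM_C (cK' _ zd) ca) _).
    apply: continuousN_C; apply: continuousM_C cb.
    exact: continuousM_C (cK _ zd) (continuous_id_C (z := z)).
  exact: (continuous_comp cc (continuous_cre (z := _))).
have mf n : measurable_fun D2 (EFin \o f n).
  apply/measurable_EFinP; apply: (measurable_on_disk (f := fun w => H w (tpow n.+1%:R^-1 p (oneBsq w))
    (dtpow n.+1%:R^-1 p (oneBsq w)))) => z zd.
  apply: cH => //; last exact: continuous_dtpow.
  by apply: continuous_creal; exact: continuous_tpow.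
have mF : measurable_fun D2 (EFin \o F).
  apply/measurable_EFinP; apply: (measurable_on_disk (f := fun w => H w (oneBsq w `^ p)
    (p * oneBsq w `^ (p - 1)))) => z zd.
  apply: cH => //; apply: continuous_creal; first exact: continuous_weight.
  exact: continuousZ_R (continuous_weight zd).
(* [3 + p = 1 + (2 + p)]: the truncated power is at most [s^p <= s^(p-1)], its derivative at most
   [(2 + p) s^(p-1)]. *)
pose N := M * M * (3 + p).
have M0 : 0 <= M.
  have d0' : disk (0 : C) by change (is_true (cabs (0 : C) < 1)); rewrite cabs0.
  by have [h _ _] := bnd 0 d0'; exact: le_trans (cabs_ge0 _) h.
have ig : leb2.-integrable D2 (EFin \o ((fun w => N * oneBsq w `^ (p - 1)) \o @pt R)).
  by apply: (eq_integrable measurable_disk2 _ _ _ (integrableZl measurable_disk2 N (integrable_weight p0))) => q _.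
have [||_ _] := dominated_convergence measurable_disk2 mf mF _ ig.
- apply: aeW => q Dq; have s0 : 0 < oneBsq (pt q) by rewrite oneBsq_gt0.
  apply: cvg_EFin; first exact: nearW.
  have -> : fine \o (fun n => (EFin \o f n) q) = fun n =>
    cre (Q (pt q) * K' (pt q)) * tpow n.+1%:R^-1 p (oneBsq (pt q)) -
    cre (Q (pt q) * K (pt q) * pt q) * dtpow n.+1%:R^-1 p (oneBsq (pt q)).
    by apply/funext => n /=; rewrite /f HE.
  rewrite /F HE; apply: cvgB; apply: cvgM; try exact: cvg_cst.
  - exact: cvg_tpow.
  - exact: cvg_dtpow.
- apply: aeW => q n Dq /=; have s0 : 0 < oneBsq (pt q) by rewrite oneBsq_gt0.
  have [bQ bK bK'] := bnd _ Dq.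
  rewrite lee_fin; apply: le_trans (ler_cre_cabs _) _; rewrite cabsM /N -!mulrA.
  apply: ler_pM; rewrite ?cabs_ge0 //.
  apply: le_trans (cabsD _ _) _; rewrite cabsN !cabsM !cabsR.
  rewrite (ger0_norm (tpow_ge0 _ _ _)) (ger0_norm (dtpow_ge0 (ltW (n0 n)) (ltW p0) s0)).
  set S := oneBsq (pt q) `^ (p - 1).
  have -> : M * ((3 + p) * S) = M * S + M * ((2 + p) * S) by ring.
  apply: lerD; apply: ler_pM; rewrite ?cabs_ge0 ?tpow_ge0 ?mulr_ge0 ?cabs_ge0 //.
  + apply: le_trans (tpow_le _ (ltW (n0 n)) s0) _; apply: powR_lep => //; first exact: ltW.
    exact: oneBsq_le1.
  + by apply: dtpow_ge0; rewrite ?(ltW (n0 n)) ?(ltW p0).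
  + rewrite -[leRHS]mul1r; apply: ler_pM; rewrite ?cabs_ge0 //.
    * by apply: dtpow_ge0; rewrite ?(ltW (n0 n)) ?(ltW p0).
    * exact: (ltW Dq).
    * by apply: dtpow_le; rewrite ?(ltW (n0 n)) ?(ltW p0).
move=> cv.
have iF : leb2.-integrable D2 (EFin \o F).
  apply: (le_integrable measurable_disk2 mF _ ig) => q Dq /=.
  have s0 : 0 < oneBsq (pt q) by rewrite oneBsq_gt0.
  have [bQ bK bK'] := bnd _ Dq.
  rewrite lee_fin; apply: le_trans (ler_norm _).
  apply: le_trans (ler_cre_cabs _) _; rewrite cabsM /N -!mulrA.
  apply: ler_pM; rewrite ?cabs_ge0 //.
  apply: le_trans (cabsD _ _) _; rewrite cabsN !cabsM !cabsR.
  rewrite normrM !(ger0_norm (powR_ge0 _ _)) (ger0_norm (ltW p0)).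
  set S := oneBsq (pt q) `^ (p - 1); have S0 : 0 <= S := powR_ge0 _ _.
  have -> : M * ((3 + p) * S) = M * (3 * S) + M * (p * S) by ring.
  apply: lerD; apply: ler_pM; rewrite ?cabs_ge0 ?powR_ge0 ?mulr_ge0 ?cabs_ge0 ?(ltW p0) //.
  + apply: (@le_trans _ _ S); last by rewrite ler_peMl // ler1n.
    by apply: powR_lep => //; [exact: ltW|exact: oneBsq_le1].
  + rewrite -[leRHS]mul1r; apply: ler_pM; rewrite ?cabs_ge0 ?mulr_ge0 ?(ltW p0) //.
    exact: (ltW Dq).
have FE : (\int[leb2]_(q in D2) (EFin \o F) q)%E = (\int[leb2]_(q in D2) F q)%:E.
  by rewrite /Rintegral fineK //; exact: (integrable_fin_num measurable_disk2 iF).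
rewrite FE in cv; have cv' := fine_cvg cv.
have E n : fine (\int[leb2]_(q in D2) (EFin \o f n) q)%E = 0.
  exact: (green_weight (d := n.+1%:R^-1) (n0 n) p0 cQ dQ dK cK' bnd).
have E0 : (fine \o (fun n => \int[leb2]_(q in D2) (EFin \o f n) q)%E) = fun=> 0.
  by apply/funext => n /=; rewrite E.
have {}cv' : (fun _ : nat => 0 : R) @ \oo --> \int[leb2]_(q in D2) F q.
  by rewrite -E0; exact: cv'.
by rewrite -[LHS](cvg_lim (@Rhausdorff R) cv') lim_cst //; exact: Rhausdorff.
Qed.

End WeightedGreen.

(** * The reproducing formula *)

Section Reproducing.
Variable R : realType.
Local Notation C := (Cplane R).
Local Notation leb2 := (@lebesgue_measure R \x @lebesgue_measure R)%E.
Local Notation plane := (measurableTypeR R * measurableTypeR R)%type.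
Local Notation D2 := (disk2 (R := R) : set plane).
Implicit Types (p a M : R) (f g h : C -> C) (z w xi : C).

(** The class of integrands: each is integrable against every weight [s^(p-1)] with [p > 0], and
    unlike [bholo] the class is stable under conjugation. *)
Definition tame h := (forall z, disk z -> {for z, continuous h}) /\
  exists M, forall z, disk z -> cabs (h z) <= M.

Definition bholo f := (forall z, disk z -> exists A, rdiff f z A 0) /\
  exists M, forall z, disk z -> cabs (f z) <= M.

Lemma bholo_tame f : bholo f -> tame f.
Proof. by move=> [df fM]; split=> // z /df[A]; exact: rdiff_continuous. Qed.

Lemma tame_cst c : tame (fun=> c).
Proof. by split; [move=> z _; exact: continuous_cst_C|exists (cabs c)]. Qed.

Lemma tameM g h : tame g -> tame h -> tame (fun w => g w * h w).
Proof.
move=> [cg [M gM]] [ch [N hN]]; split.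
  by move=> z zd; exact: continuousM_C (cg _ zd) (ch _ zd).
by exists (M * N) => z zd; rewrite cabsM ler_pM ?cabs_ge0 ?gM ?hN.
Qed.

Lemma tameD g h : tame g -> tame h -> tame (fun w => g w + h w).
Proof.
move=> [cg [M gM]] [ch [N hN]]; split.
  by move=> z zd; exact: continuousD_C (cg _ zd) (ch _ zd).
by exists (M + N) => z zd; apply: le_trans (cabsD _ _) _; rewrite lerD ?gM ?hN.
Qed.

Lemma tameJ h : tame h -> tame (fun w => cconj (h w)).
Proof.
move=> [ch [N hN]]; split; first by move=> z zd; exact: continuousJ_C (ch _ zd).
by exists N => z zd; rewrite cabsJ hN.
Qed.

Lemma bholo_cst c : bholo (fun=> c).
Proof.
by split; [move=> z _; exists 0; exact: rdiff_cst|exists (cabs c)].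
Qed.

Lemma bholoM f g : bholo f -> bholo g -> bholo (fun w => f w * g w).
Proof.
move=> bf bg; split; last by have [_] := tameM (bholo_tame bf) (bholo_tame bg).
move=> z zd; have [A dA] := bf.1 z zd; have [B dB] := bg.1 z zd.
by exists (A * g z + f z * B); have := rdiffM dA dB; rewrite mul0r mulr0 addr0.
Qed.

Lemma bholoD f g : bholo f -> bholo g -> bholo (fun w => f w + g w).
Proof.
move=> bf bg; split; last by have [_] := tameD (bholo_tame bf) (bholo_tame bg).
move=> z zd; have [A dA] := bf.1 z zd; have [B dB] := bg.1 z zd.
by exists (A + B); have := rdiffD dA dB; rewrite addr0.
Qed.

Lemma bholo_comp f g : bholo f -> bholo g -> (forall z, disk z -> disk (g z)) ->
  bholo (fun w => f (g w)).
Proof.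
move=> bf bg gd; split; last by have [M fM] := bf.2; exists M => z /gd /fM.
move=> z zd; have [A dA] := bf.1 _ (gd _ zd); have [B dB] := bg.1 z zd.
by exists (A * B); have := rdiff_comp dB dA; rewrite mul0r mulr0 mul0r !addr0.
Qed.

(** Not normalized; used with [p = gamma + 1], the missing factor being restored in [cint_dAgE]. *)
Definition wint p h : C :=
  pt (\int[leb2]_(q in D2) (cre (h (pt q)) * oneBsq (pt q) `^ (p - 1)),
      \int[leb2]_(q in D2) (cim (h (pt q)) * oneBsq (pt q) `^ (p - 1))).

Lemma wint_re p h : cre (wint p h) =
  \int[leb2]_(q in D2) (cre (h (pt q)) * oneBsq (pt q) `^ (p - 1)).
Proof. by []. Qed.

Lemma wint_im p h : cim (wint p h) =
  \int[leb2]_(q in D2) (cim (h (pt q)) * oneBsq (pt q) `^ (p - 1)).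
Proof. by []. Qed.

Lemma integrable_bounded_weight p (u : C -> R) M : 0 < p ->
  (forall z, disk z -> {for z, continuous u}) -> (forall z, disk z -> `|u z| <= M) ->
  leb2.-integrable D2 (EFin \o ((fun w => u w * oneBsq w `^ (p - 1)) \o @pt R)).
Proof.
move=> p0 cu uM.
have iM : leb2.-integrable D2 (EFin \o ((fun w => M * oneBsq w `^ (p - 1)) \o @pt R)).
  by apply: (eq_integrable measurable_disk2 _ _ _
    (integrableZl measurable_disk2 M (integrable_weight p0))) => q _.
apply: integrable_on_disk iM => z zd.
  exact: continuousM_R (cu _ zd) (continuous_weight zd).
by rewrite normrM (ger0_norm (powR_ge0 _ _)) ler_wpM2r ?powR_ge0 ?uM.
Qed.

Lemma integrable_wint_re p h : 0 < p -> tame h ->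
  leb2.-integrable D2 (EFin \o (fun q => cre (h (pt q)) * oneBsq (pt q) `^ (p - 1))).
Proof.
move=> p0 [ch [M hM]]; apply: (integrable_bounded_weight (u := fun w => cre (h w)) (M := M)) => // z zd.
  exact: (continuous_comp (ch _ zd) (continuous_cre (z := _))).
exact: le_trans (ler_cre_cabs _) (hM _ zd).
Qed.

Lemma integrable_wint_im p h : 0 < p -> tame h ->
  leb2.-integrable D2 (EFin \o (fun q => cim (h (pt q)) * oneBsq (pt q) `^ (p - 1))).
Proof.
move=> p0 [ch [M hM]]; apply: (integrable_bounded_weight (u := fun w => cim (h w)) (M := M)) => // z zd.
  exact: (continuous_comp (ch _ zd) (continuous_cim (z := _))).
exact: le_trans (ler_cim_cabs _) (hM _ zd).
Qed.

Lemma wintD p g h : 0 < p -> tame g -> tame h ->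
  wint p (fun w => g w + h w) = wint p g + wint p h.
Proof.
move=> p0 tg th; apply: complexP; rewrite ?creD ?cimD ?wint_re ?wint_im.
  rewrite -RintegralD; [|exact: measurable_disk2|exact: integrable_wint_re|exact: integrable_wint_re].
  by apply: eq_Rintegral => q _; rewrite creD mulrDl.
rewrite -RintegralD; [|exact: measurable_disk2|exact: integrable_wint_im|exact: integrable_wint_im].
by apply: eq_Rintegral => q _; rewrite cimD mulrDl.
Qed.

Lemma wintZ p c h : 0 < p -> tame h -> wint p (fun w => c * h w) = c * wint p h.
Proof.
move=> p0 th; have ir := integrable_wint_re p0 th; have ii := integrable_wint_im p0 th.
have Z (k : R) (u : plane -> R) : leb2.-integrable D2 (EFin \o u) ->
    leb2.-integrable D2 (EFin \o (fun q => k * u q)).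
  move=> iu.
  by apply: (eq_integrable measurable_disk2 _ _ _ (integrableZl measurable_disk2 k iu)) => q _.
apply: complexP; rewrite ?creM ?cimM !wint_re !wint_im.
  rewrite -!RintegralZl //; try exact: measurable_disk2.
  rewrite -RintegralB; [|exact: measurable_disk2|exact: Z|exact: Z].
  by apply: eq_Rintegral => q _; rewrite creM; ring.
rewrite -!RintegralZl //; try exact: measurable_disk2.
rewrite -RintegralD; [|exact: measurable_disk2|exact: Z|exact: Z].
by apply: eq_Rintegral => q _; rewrite cimM; ring.
Qed.

Lemma wintJ p h : 0 < p -> tame h -> wint p (fun w => cconj (h w)) = cconj (wint p h).
Proof.
move=> p0 th; apply: complexP; rewrite ?creJ ?cimJ !(wint_re, wint_im).
  by apply: eq_Rintegral => q _; rewrite creJ.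
rewrite -[RHS]mulN1r -RintegralZl; [|exact: measurable_disk2|exact: integrable_wint_im].
by apply: eq_Rintegral => q _; rewrite cimJ mulN1r mulNr.
Qed.

Definition bkernel xi a w : C := (cpow (1 - cconj xi * w) a)^-1.

(** Keeps the base of the power in the right half-plane, where the principal branch is holomorphic,
    and at a distance from 0 that is uniform in [w]. *)
Lemma cre_oneBJM_ge xi w : disk xi -> disk w -> 1 - cabs xi <= cre (1 - cconj xi * w).
Proof.
move=> x1 w1; rewrite creD creN; have -> : cre (1 : C) = 1 by [].
have := ler_cre_cabs (cconj xi * w); rewrite cabsM cabsJ ler_norml => /andP[_ h].
have := ler_piMr (cabs_ge0 xi) (ltW w1); lra.
Qed.

Lemma cre_oneBJM_gt0 xi w : disk xi -> disk w -> 0 < cre (1 - cconj xi * w).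
Proof.
by move=> x1 w1; apply: lt_le_trans (cre_oneBJM_ge x1 w1); rewrite subr_gt0.
Qed.

Lemma oneBJM_neq0 xi w : disk xi -> disk w -> 1 - cconj xi * w != 0.
Proof.
move=> x1 w1; apply: contraTneq (cre_oneBJM_gt0 x1 w1) => ->.
by rewrite /cre /= ltxx.
Qed.

Lemma bkernel_neq0 xi a w : disk xi -> disk w -> bkernel xi a w != 0.
Proof. by move=> x1 w1; rewrite /bkernel invr_eq0 cpow_neq0 // oneBJM_neq0. Qed.

Lemma cabs_bkernel xi a w : disk xi -> disk w ->
  cabs (bkernel xi a w) = (cabs (1 - cconj xi * w) `^ a)^-1.
Proof. by move=> x1 w1; rewrite /bkernel cabsV cabs_cpow // oneBJM_neq0. Qed.

Lemma bkernel_le xi a w : 0 <= a -> disk xi -> disk w ->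
  cabs (bkernel xi a w) <= ((1 - cabs xi) `^ a)^-1.
Proof.
move=> a0 x1 w1; rewrite cabs_bkernel //.
have x0 : 0 < 1 - cabs xi by rewrite subr_gt0.
have h : 1 - cabs xi <= cabs (1 - cconj xi * w).
  by apply: le_trans (cre_oneBJM_ge x1 w1) _; apply: le_trans (ler_norm _) (ler_cre_cabs _).
have h0 := lt_le_trans x0 h.
by rewrite lef_pV2 ?posrE ?powR_gt0 // ge0_ler_powR // ?nnegrE ltW.
Qed.

Lemma bkernelS xi a w : disk xi -> disk w -> bkernel xi a w = bkernel xi (a + 1) w * (1 - cconj xi * w).
Proof.
move=> x1 w1; have n0 := oneBJM_neq0 x1 w1.
rewrite /bkernel cpowS //; move: (n0) (cpow_neq0 a n0).
move: (1 - _) => v; move: (cpow v a) => u v0 u0.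
by field; rewrite u0 v0.
Qed.

Lemma rdiff_bkernel xi a w : disk xi -> disk w ->
  rdiff (bkernel xi a) w (creal a * cconj xi * bkernel xi (a + 1) w) 0.
Proof.
move=> x1 w1; have n0 := oneBJM_neq0 x1 w1.
have dl : rdiff (fun w => 1 - cconj xi * w) w (- cconj xi) 0.
  have := rdiffD (rdiff_cst 1 w) (rdiffM (rdiff_cst (- cconj xi) w) (rdiff_id w)).
  have -> : (fun u : C => 1 + - cconj xi * id u) = (fun w => 1 - cconj xi * w).
    by apply/funext => u; rewrite mulNr.
  by congr rdiff; ring.
have dc := rdiff_comp dl (rdiff_cpow a (cre_oneBJM_gt0 x1 w1)).
have := rdiffV (F := fun w => cpow (1 - cconj xi * w) a) (cpow_neq0 a n0) dc; congr rdiff.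
  rewrite /bkernel cpowS //; move: (n0) (cpow_neq0 a n0).
  move: (1 - _) => v; move: (cpow v a) => u v0 u0.
  by field; rewrite u0 v0.
by rewrite !(mul0r, mulr0, addr0, oppr0).
Qed.

Lemma bholo_bkernel xi a : 0 <= a -> disk xi -> bholo (bkernel xi a).
Proof.
move=> a0 x1; split; first by move=> z zd; eexists; exact: rdiff_bkernel.
by exists ((1 - cabs xi) `^ a)^-1 => z zd; exact: bkernel_le.
Qed.

Lemma disk0 : disk (0 : C).
Proof. by change (is_true (cabs (0 : C) < 1)); rewrite cabs0. Qed.

Lemma bkernel_at0 xi a : bkernel xi a 0 = 1.
Proof. by rewrite /bkernel mulr0 subr0 cpow1 invr1. Qed.

Lemma bkernel0 a w : bkernel 0 a w = 1.
Proof. by rewrite /bkernel cconj0 mul0r subr0 cpow1 invr1. Qed.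

(** At [xi] only continuity is claimed, which is what the exceptional point in Green's formula
    allows. *)
Lemma difference_quotient f xi : bholo f -> disk xi -> exists q : C -> C,
  [/\ forall z, q z * (z - xi) = f z - f xi,
      forall z, disk z -> z != xi -> exists A, rdiff q z A 0 & tame q].
Proof.
move=> bf x1; have [A [a [b [H ca cb az bz]]]] := bf.1 _ x1.
have [q0 cq0] : exists q0 : C, {for xi, continuous (fun z => if z == xi then q0 else (f z - f xi) / (z - xi))}.
  exists A; apply/continuousCP => e e0.
  have e20 : 0 < e / 2 by rewrite divr_gt0.
  have /continuousCP/(_ _ e20)[d1 d10 H1] := ca.
  have /continuousCP/(_ _ e20)[d2 d20 H2] := cb.
  exists (Num.min d1 d2); first by rewrite lt_min d10.
  move=> w; rewrite lt_min eqxx => /andP[h1 h2].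
  case: eqVneq => [_|wx]; first by rewrite subrr cabs0.
  have w0 : w - xi != 0 by rewrite subr_eq0.
  have := H1 _ h1; have := H2 _ h2; rewrite az bz subr0 => K2 K1.
  have -> : (f w - f xi) / (w - xi) - A = (a w - A) + b w * (cconj (w - xi) / (w - xi)).
    rewrite H; move: (w - xi) w0 => u u0; move: (cconj u) => v.
    by field.
  apply: le_lt_trans (cabsD _ _) _; rewrite [e]splitr; apply: ltrD => //.
  by rewrite !cabsM cabsJ cabsV divff ?mulr1 // cabs_eq0.
pose q z := if z == xi then q0 else (f z - f xi) / (z - xi).
exists q.
have qE z : z != xi -> q z = (f z - f xi) / (z - xi) by rewrite /q => /negbTE ->.
have dq z : disk z -> z != xi -> exists A, rdiff q z A 0.
  move=> zd zx; have [B dB] := bf.1 _ zd.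
  have d1 : rdiff (fun w => f w + - f xi) z (B + 0) (0 + 0) := rdiffD dB (rdiff_cst _ _).
  have d2 : rdiff (fun w => w + - xi) z (1 + 0) (0 + 0) := rdiffD (rdiff_id z) (rdiff_cst _ _).
  have n0 : z + - xi != 0 by rewrite subr_eq0.
  have := rdiffM d1 (rdiffV (F := fun w => w + - xi) n0 d2); rewrite !(addr0, mulr0, mul0r, oppr0).
  set B' := (X in rdiff _ _ X _) => dB'; exists B'.
  apply: (near_rdiff (d := cabs (z - xi)) _ _ dB'); first by rewrite cabs_gt0.
  move=> w wz; rewrite qE //; apply: contraTneq wz => ->.
  by rewrite cabsBC ltxx.
have cq z : disk z -> {for z, continuous q}.
  move=> zd; have [->|zx] := eqVneq z xi; first exact: cq0.
  by have [B dB] := dq _ zd zx; exact: rdiff_continuous dB.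
split=> //.
  move=> z; rewrite /q; case: eqVneq => [->|zx]; first by rewrite !subrr mulr0.
  by rewrite divfK // subr_eq0.
split=> //; have [M fM] := bf.2.
have /continuousCP/(_ _ ltr01)[d d0 Hd] := cq0.
have M0 : 0 <= M := le_trans (cabs_ge0 _) (fM _ x1).
(* Within [d] of [xi], [q] stays within 1 of [q0]; farther away the numerator is at most [2 M] and
   the denominator at least [d]. *)
exists (cabs q0 + 1 + (M + M) / d) => z zd.
have [zx|zx] := ltP (cabs (z - xi)) d.
  have := Hd _ zx; rewrite -/q eqxx -/(q z) => h.
  have -> : q z = q0 + (q z - q0) by ring.
  apply: le_trans (cabsD _ _) _.
  have : 0 <= (M + M) / d by apply: divr_ge0 (addr_ge0 M0 M0) (ltW d0).
  move: h; rewrite -/(q z); lra.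
have zx' : z != xi by apply: contraTneq zx => ->; rewrite subrr cabs0 -ltNge.
rewrite qE // cabsM cabsV -[leLHS]add0r lerD ?addr_ge0 ?cabs_ge0 //.
apply: ler_pM; rewrite ?cabs_ge0 ?invr_ge0 ?cabs_ge0 //.
  by apply: le_trans (cabsD _ _) _; rewrite cabsN lerD ?fM.
by rewrite lef_pV2 // posrE (lt_le_trans d0 zx).
Qed.

Lemma reproducing0_re p f xi : 0 < p -> bholo f -> disk xi ->
  cre (wint p (fun w => (f w - f xi) * cconj (bkernel xi (p + 1) w))) = 0.
Proof.
move=> p0 bf x1; have [q [qE dq [cq [Mq qM]]]] := difference_quotient bf x1.
have [_ [M1 KM1]] := bholo_bkernel (ltW p0) x1.
have p10 : 0 <= p + 1 by rewrite addr_ge0 ?ltW.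
have [_ [M2 KM2]] := bholo_bkernel p10 x1.
pose K w := cconj (bkernel xi p w).
pose K' w := cconj (creal p * cconj xi * bkernel xi (p + 1) w).
pose M := Num.max Mq (Num.max M1 (cabs (creal p * cconj xi) * M2)).
have cK' z : disk z -> {for z, continuous K'}.
  move=> zd; apply: continuousJ_C; apply: continuousM_C; first exact: continuous_cst_C.
  exact: (rdiff_continuous (rdiff_bkernel (p + 1) x1 zd)).
have := weighted_green (xi := xi) (Q := q) (K := K) (K' := K') (M := M) p0 cq dq _ cK' _.
(* After extracting [s^(p-1)] and one kernel of exponent [p + 1], this is [xi (1 - |w|^2) - w (1 -
   xi conj(w)) = xi - w], and [q w * (w - xi)] is the increment of [f]. *)
have E w : disk w -> cre (q w * (K' w * creal (oneBsq w `^ p) -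
     K w * w * creal (p * oneBsq w `^ (p - 1)))) =
   - p * (cre ((f w - f xi) * cconj (bkernel xi (p + 1) w)) * oneBsq w `^ (p - 1)).
  move=> wd; have s0 : 0 < oneBsq w by rewrite oneBsq_gt0.
  rewrite (powRSl p s0) -qE /K /K' (bkernelS p x1 wd) !cconjM !cconjR cconjK.
  have -> : cconj (1 - cconj xi * w) = 1 - xi * cconj w.
    by rewrite cconjD cconj1 cconjN cconjM cconjK.
  rewrite !crealM oneBsqE.
  set k := cconj (bkernel _ _ _); set S := creal (_ `^ _).
  have -> : q w * (creal p * xi * k * ((1 + -1 * (w * cconj w)) * S) -
     k * (1 - xi * cconj w) * w * (creal p * S)) =
     creal (- p) * (q w * (w - xi) * k) * S by rewrite crealN; ring.
  by rewrite /S !creM !cimM !creR !cimR; ring.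
have -> : \int[leb2]_(u in D2) cre (q (pt u) * (K' (pt u) * creal (oneBsq (pt u) `^ p) -
     K (pt u) * pt u * creal (p * oneBsq (pt u) `^ (p - 1)))) =
   - p * cre (wint p (fun w => (f w - f xi) * cconj (bkernel xi (p + 1) w))).
  have t0 : tame (fun w => (f w - f xi) * cconj (bkernel xi (p + 1) w)).
    apply: tameM; first exact: tameD (bholo_tame bf) (tame_cst (- f xi)).
    exact/tameJ/bholo_tame/bholo_bkernel.
  rewrite wint_re -RintegralZl; last exact: (integrable_wint_re p0 t0).
    2: exact: measurable_disk2.
  by apply: eq_Rintegral => u /set_mem ud; exact: E.
move=> h; have {h} : - p * cre (wint p (fun w => (f w - f xi) * cconj (bkernel xi (p + 1) w))) = 0.
  apply: h => z zd.
    by eexists; have := rdiffJ (rdiff_bkernel p x1 zd); exact.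
  split; first by rewrite le_max qM.
    by rewrite /K cabsJ !le_max KM1 ?orbT.
  by rewrite /K' cabsJ cabsM !le_max ler_wpM2l ?cabs_ge0 ?KM2 ?orbT.
by move=> /eqP; rewrite mulf_eq0 oppr_eq0 gt_eqF //= => /eqP.
Qed.

(** The imaginary part is the real part of the formula for [- i f]. *)
Lemma reproducing0 p f xi : 0 < p -> bholo f -> disk xi ->
  wint p (fun w => (f w - f xi) * cconj (bkernel xi (p + 1) w)) = 0.
Proof.
move=> p0 bf x1; apply: complexP; first exact: reproducing0_re.
have p10 : 0 <= p + 1 by rewrite addr_ge0 ?ltW.
have t0 : tame (fun w => (f w - f xi) * cconj (bkernel xi (p + 1) w)).
  apply: tameM; first exact: tameD (bholo_tame bf) (tame_cst (- f xi)).
  exact/tameJ/bholo_tame/bholo_bkernel.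
have := reproducing0_re p0 (bholoM (bholo_cst (- ci R)) bf) x1.
have -> : (fun w => (- ci R * f w - - ci R * f xi) * cconj (bkernel xi (p + 1) w)) =
   (fun w => - ci R * ((f w - f xi) * cconj (bkernel xi (p + 1) w))).
  by apply/funext => w; ring.
rewrite wintZ // creM; have -> : cre (- ci R) = 0 by rewrite creN oppr0.
by have -> : cim (- ci R) = -1 by []; rewrite mul0r sub0r mulN1r opprK.
Qed.

Definition mass p : R := cre (wint p (fun=> 1)).

Lemma wint1 p : 0 < p -> wint p (fun=> 1) = creal (mass p).
Proof.
move=> p0; apply: complexP => //; rewrite wint_im.
rewrite (eq_Rintegral _ (g := fun=> 0)); last by move=> q _; rewrite mul0r.
by rewrite Rintegral_cst ?mul0r //; exact: measurable_disk2.
Qed.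

(** Mean value property: [reproducing0] for the kernel itself, at the point 0, where it takes the
    value 1 and where the kernel based at 0 is constant. *)
Lemma wint_bkernel p xi : 0 < p -> disk xi -> wint p (bkernel xi (p + 1)) = creal (mass p).
Proof.
move=> p0 x1; have p10 : 0 <= p + 1 by rewrite addr_ge0 ?ltW.
have bk := bholo_bkernel p10 x1.
have := reproducing0 p0 bk disk0.
have -> : (fun w => (bkernel xi (p + 1) w - bkernel xi (p + 1) 0) * cconj (bkernel 0 (p + 1) w)) =
    (fun w => bkernel xi (p + 1) w + - 1).
  by apply/funext => w; rewrite bkernel_at0 bkernel0 cconj1 mulr1.
rewrite (wintD p0 (bholo_tame bk) (tame_cst (- 1))).
have -> : (fun _ : C => - 1 : C) = (fun w => - 1 * 1) by apply/funext => w; rewrite mulr1.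
rewrite wintZ //; last exact: tame_cst.
by rewrite wint1 // mulN1r => /eqP; rewrite subr_eq0 => /eqP.
Qed.

Lemma reproducing p f xi : 0 < p -> bholo f -> disk xi ->
  wint p (fun w => f w * cconj (bkernel xi (p + 1) w)) = f xi * creal (mass p).
Proof.
move=> p0 bf x1; have p10 : 0 <= p + 1 by rewrite addr_ge0 ?ltW.
have tk : tame (fun w => cconj (bkernel xi (p + 1) w)) by exact/tameJ/bholo_tame/bholo_bkernel.
have -> : (fun w => f w * cconj (bkernel xi (p + 1) w)) =
  (fun w => (f w - f xi) * cconj (bkernel xi (p + 1) w) + f xi * cconj (bkernel xi (p + 1) w)).
  by apply/funext => w; ring.
have t1 := tameM (tameD (bholo_tame bf) (tame_cst (- f xi))) tk.
have t2 := tameM (tame_cst (f xi)) tk.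
rewrite (wintD p0 t1 t2) reproducing0 // add0r wintZ // wintJ //; last exact/bholo_tame/bholo_bkernel.
by rewrite wint_bkernel // cconjR.
Qed.

Lemma mass_gt0 p : 0 < p -> 0 < mass p.
Proof.
move=> p0; rewrite /mass wint_re.
have i1 := integrable_wint_re p0 (tame_cst 1).
pose A := square 0 0 (2^-1 : R).
have mA : measurable A by exact: measurable_square.
(* On the square [A] one has [1/2 <= oneBsq <= 1]; the minimum covers both signs of [p - 1]. *)
pose c : R := Num.min 1 (2^-1 `^ (p - 1)).
have c0 : 0 < c by rewrite lt_min ltr01 powR_gt0.
have cA : c * (2^-1 * 2^-1) <= \int[leb2]_(q in A) (cre (1 : C) * oneBsq (pt q) `^ (p - 1)).
  rewrite -(fine_square 0 0 (l := 2^-1)) // -(Rintegral_cst leb2 mA c).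
  apply: le_Rintegral => //.
  - apply: measurable_bounded_integrable => //; [exact: square_fin|exact: bounded_cst].
  - by apply: integrableS i1 => //; [exact: measurable_disk2|exact: square_sub_disk2].
  move=> [s t] [/=]; rewrite !in_itv /= !add0r => /andP[s0 s1] /andP[t0 t1].
  suff hc : c <= 1 * oneBsq (pt (s, t)) `^ (p - 1) by exact: hc.
  rewrite mul1r /oneBsq cabs_sqr cre_pt cim_pt /=.
  have h1 : 2^-1 <= 1 - (s ^+ 2 + t ^+ 2) by nra.
  have h2 : 1 - (s ^+ 2 + t ^+ 2) <= 1 by nra.
  set x := 1 - _ in h1 h2 *; have x0 : 0 < x by lra.
  rewrite /c ge_min; have [q0|q0] := leP 0 (p - 1).
    by rewrite ge0_ler_powR ?orbT // nnegrE ltW.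
  apply/orP; left; rewrite -[X in _ `^ X]opprK powRN.
  have nq0 : 0 <= - (p - 1) by lra.
  rewrite -[leLHS]invr1 lef_pV2 ?posrE ?powR_gt0 //.
  have := ge0_ler_powR nq0 (x := x) (y := 1); rewrite !nnegrE powR1 ler01 => h.
  by apply: h => //; exact: ltW.
apply: (@lt_le_trans _ _ (c * (2^-1 * 2^-1))); first by rewrite !mulr_gt0.
apply: le_trans cA _.
have iA : leb2.-integrable A (EFin \o (fun q => cre (1 : C) * oneBsq (pt q) `^ (p - 1))).
  by apply: integrableS i1 => //; [exact: measurable_disk2|exact: square_sub_disk2].
apply: fine_le.
- exact: (integrable_fin_num mA iA).
- exact: (integrable_fin_num measurable_disk2 i1).
apply: ge0_subset_integral => //.
- exact: measurable_disk2.
- by case/integrableP: i1.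
- by move=> q _; rewrite lee_fin mulr_ge0 ?powR_ge0.
- exact: square_sub_disk2.
Qed.

End Reproducing.

(** * The maximum principle and the Berezin transform *)

Section MaximumPrinciple.
Variable R : realType.
Local Notation C := (Cplane R).
Implicit Types (p a M : R) (f g h : C -> C) (z w xi : C).

Lemma cpow_creal (x s : R) : 0 < x -> cpow (creal x) s = creal (x `^ s).
Proof.
move=> x0; have e : cabs (creal x) = x by rewrite cabsR gtr0_norm.
rewrite /cpow /carg e /= lexx divff ?gt_eqF // acos1 mulr0 cos0 sin0.
by apply: complexP; rewrite /cre /cim /=; ring.
Qed.

Lemma bkernel_diag xi a : disk xi -> bkernel xi a xi = creal (oneBsq xi `^ a)^-1.
Proof.
move=> x1; have s0 : 0 < oneBsq xi by rewrite oneBsq_gt0.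
rewrite /bkernel; have -> : 1 - cconj xi * xi = creal (oneBsq xi).
  by rewrite oneBsqE; ring.
by rewrite cpow_creal // crealV.
Qed.

Lemma bkernel_ge xi a w : 0 <= a -> disk xi -> disk w -> (2 `^ a)^-1 <= cabs (bkernel xi a w).
Proof.
move=> a0 x1 w1; rewrite cabs_bkernel //.
have n0 : 0 < cabs (1 - cconj xi * w) by rewrite cabs_gt0 oneBJM_neq0.
rewrite lef_pV2 ?posrE ?powR_gt0 // ge0_ler_powR ?nnegrE ?(ltW n0) //.
apply: le_trans (cabsD _ _) _; rewrite cabs1 cabsN cabsM cabsJ.
have := ler_pM (cabs_ge0 xi) (cabs_ge0 w) (ltW x1) (ltW w1); lra.
Qed.

Lemma le_wint_re p g h : 0 < p -> tame g -> tame h ->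
  (forall z, disk z -> cre (g z) <= cre (h z)) -> cre (wint p g) <= cre (wint p h).
Proof.
move=> p0 tg th gh; rewrite !wint_re; apply: le_Rintegral.
- exact: measurable_disk2.
- exact: integrable_wint_re.
- exact: integrable_wint_re.
- by move=> q qd; rewrite ler_wpM2r ?powR_ge0 // gh.
Qed.

(** Reproducing [(M - g) k] at [xi], with [k] the kernel, integrates [M - Re g >= 0] against
    [|k|^2]; reproducing [M - g] at 0 gives its plain integral. The two are compared through
    [1 - |xi| <= |1 - conj(xi) w| <= 2]. *)
Lemma harnack g M xi : bholo g -> (forall z, disk z -> cre (g z) <= M) -> disk xi ->
  (2 `^ 2)^-1 ^+ 2 * (M - cre (g 0)) <= (M - cre (g xi)) * (oneBsq xi `^ 2)^-1 /\
  (M - cre (g xi)) * (oneBsq xi `^ 2)^-1 <=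
    ((1 - cabs xi) `^ 2)^-1 ^+ 2 * (M - cre (g 0)).
Proof.
(* The unweighted case, in which the kernel has exponent 2. *)
move=> bg gM x1; pose p : R := 1; have p0 : 0 < p by [].
have pE : p + 1 = 2 by rewrite /p -natr1.
have two0 : (0 : R) <= 2 by [].
have bk := bholo_bkernel two0 x1; have tk := bholo_tame bk.
pose F w := creal M + - 1 * g w.
have bF : bholo F by exact: bholoD (bholo_cst _) (bholoM (bholo_cst _) bg).
have tF := bholo_tame bF.
have F_re w : cre (F w) = M - cre (g w).
  by rewrite /F creD creM creR creN cimN /cre /cim /=; ring.
have Fge w : disk w -> 0 <= cre (F w) by move=> /gM h; rewrite F_re subr_ge0.
have E0 : cre (wint p F) = (M - cre (g 0)) * mass p.
  have := reproducing p0 bF (disk0 R).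
  have -> : (fun w => F w * cconj (bkernel 0 (p + 1) w)) = F.
    by apply/funext => w; rewrite bkernel0 cconj1 mulr1.
  by move=> ->; rewrite creM creR cimR mulr0 subr0 F_re.
have E1 : cre (wint p (fun w => F w * bkernel xi 2 w * cconj (bkernel xi 2 w))) =
    (M - cre (g xi)) * (oneBsq xi `^ 2)^-1 * mass p.
  have := reproducing p0 (bholoM bF bk) x1; rewrite pE => ->.
  by rewrite creM creR cimR mulr0 subr0 bkernel_diag // creM creR cimR mulr0 subr0 F_re.
have t1 : tame (fun w => F w * bkernel xi 2 w * cconj (bkernel xi 2 w)).
  exact: tameM (tameM tF tk) (tameJ tk).
have kE w : cre (F w * bkernel xi 2 w * cconj (bkernel xi 2 w)) = cabs (bkernel xi 2 w) ^+ 2 * cre (F w).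
  by rewrite -mulrA mulzJ creM creR cimR mulr0 subr0 mulrC.
have mp := mass_gt0 p0.
have cZ (c : R) : cre (wint p (fun w => creal c * F w)) = c * cre (wint p F).
  by rewrite wintZ // creM creR cimR mul0r subr0.
split.
  rewrite -(ler_pM2r mp) -E1 -mulrA -E0 -cZ.
  apply: (le_wint_re p0 (tameM (tame_cst _) tF) t1) => w wd.
  rewrite kE creM creR cimR mul0r subr0 ler_wpM2r ?Fge //.
  have := bkernel_ge two0 x1 wd.
  by rewrite ler_pXn2r ?nnegrE ?cabs_ge0 // invr_ge0 powR_ge0.
rewrite -(ler_pM2r mp) -E1 -mulrA -E0 -cZ.
apply: (le_wint_re p0 t1 (tameM (tame_cst _) tF)) => w wd.
rewrite kE creM creR cimR mul0r subr0 ler_wpM2r ?Fge //.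
have := bkernel_le two0 x1 wd.
by rewrite ler_pXn2r ?nnegrE ?cabs_ge0 // invr_ge0 powR_ge0.
Qed.

Definition vanishes_at_boundary g := forall e : R, 0 < e ->
  exists2 r : R, r < 1 & forall z, disk z -> r <= cabs z -> cabs (g z) <= e.

(** Suppose the supremum [M] of [Re g] is positive. Near the circle [Re g <= M / 2]; the upper
    Harnack bound at one such point gives [Re g(0) < M], and the lower bound then keeps [Re g] below
    [M - eta] on the inner disk, so [M] is not the supremum. *)
Lemma maximum_re g : bholo g -> vanishes_at_boundary g ->
  forall z, disk z -> cre (g z) <= 0.
Proof.
move=> bg vg; have [N gN] := bg.2.
pose S : set R := [set cre (g z) | z in @disk R].
have S0 : S !=set0 by exists (cre (g 0)); exists 0 => //; exact: disk0.
have Sub : has_ubound S.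
  exists N => _ [z zd <-]; apply: le_trans (ler_norm _) _.
  exact: le_trans (ler_cre_cabs _) (gN _ zd).
pose M := sup S.
have gM z : disk z -> cre (g z) <= M by move=> zd; apply: ub_le_sup => //; exists z.
suff M0 : M <= 0 by move=> z /gM h; exact: le_trans h M0.
rewrite leNgt; apply/negP => M0.
have M20 : 0 < M / 2 by rewrite divr_gt0.
have [r' r'1 Hr'] := vg _ M20.
pose r := Num.max r' 0.
have r1 : r < 1 by rewrite gt_max r'1 ltr01.
have r0 : 0 <= r by rewrite le_max lexx orbT.
have Hr z : disk z -> r <= cabs z -> cre (g z) <= M / 2.
  move=> zd; rewrite ge_max => /andP[rz _]; apply: le_trans (ler_norm _) _.
  exact: le_trans (ler_cre_cabs _) (Hr' _ zd rz).
pose x1 : C := creal ((1 + r) / 2).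
have x1E : cabs x1 = (1 + r) / 2 by rewrite cabsR ger0_norm //; lra.
have x1d : disk x1 by change (is_true (cabs x1 < 1)); rewrite x1E; lra.
have g1 : 0 < M - cre (g x1).
  have : cre (g x1) <= M / 2 by apply: Hr => //; rewrite x1E; lra.
  lra.
have g0 : 0 < M - cre (g 0).
  have [_ h] := harnack bg gM x1d.
  have s0 : 0 < oneBsq x1 by rewrite oneBsq_gt0.
  have : 0 < (M - cre (g x1)) * (oneBsq x1 `^ 2)^-1 by rewrite mulr_gt0 // invr_gt0 powR_gt0.
  move=> /lt_le_trans/(_ h); rewrite pmulr_rgt0 // exprn_gt0 // invr_gt0 powR_gt0 //.
  by rewrite subr_gt0.
pose K : R := (1 - r ^+ 2) `^ 2.
have r21 : 0 < 1 - r ^+ 2 by rewrite subr_gt0 expr_lt1.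
have K0 : 0 < K by rewrite powR_gt0.
(* The lower Harnack bound, with [oneBsq z] replaced by its least value [1 - r^2] on [|z| <= r]. *)
pose eta := (2 `^ 2)^-1 ^+ 2 * (M - cre (g 0)) * K.
have eta0 : 0 < eta by rewrite !mulr_gt0 // ?exprn_gt0 ?invr_gt0 ?powR_gt0.
have bound z : disk z -> cre (g z) <= Num.max (M - eta) (M / 2).
  move=> zd; rewrite le_max; have [rz|rz] := leP r (cabs z).
    by rewrite Hr ?orbT.
  apply/orP; left; have [h _] := harnack bg gM zd.
  have s0 : 0 < oneBsq z by rewrite oneBsq_gt0.
  have sK : K <= oneBsq z `^ 2.
    apply: ge0_ler_powR; rewrite ?nnegrE ?(ltW r21) ?(ltW s0) //.
    by rewrite /oneBsq lerD2l lerN2 ler_pXn2r ?nnegrE ?cabs_ge0 // ltW.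
  have d0 : 0 < oneBsq z `^ 2 by rewrite powR_gt0.
  move: h; rewrite ler_pdivlMr // => h.
  have : eta <= (2 `^ 2)^-1 ^+ 2 * (M - cre (g 0)) * oneBsq z `^ 2.
    by rewrite ler_wpM2l // mulr_ge0 ?(ltW g0) // exprn_ge0 // invr_ge0 powR_ge0.
  lra.
have : M <= Num.max (M - eta) (M / 2).
  by apply: ge_sup => // _ [z zd <-]; exact: bound.
by rewrite le_max => /orP[]; lra.
Qed.

(** The product of [g] with the constant [conj(g z0)] has real part [|g z0|^2] at [z0], which the
    maximum principle makes nonpositive. *)
Lemma vanishing_bholo g : bholo g -> vanishes_at_boundary g ->
  forall z, disk z -> g z = 0.
Proof.
move=> bg vg z0 z0d; pose c := cconj (g z0).
have vf : vanishes_at_boundary (fun w => c * g w).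
  move=> e e0; have c1 : 0 < cabs c + 1 by rewrite ltr_wpDl ?cabs_ge0.
  have e'0 : 0 < e / (cabs c + 1) by rewrite divr_gt0.
  have [r r1 Hr] := vg _ e'0; exists r => // z zd rz.
  rewrite cabsM; apply: le_trans (ler_wpM2l (cabs_ge0 c) (Hr _ zd rz)) _.
  by rewrite mulrA ler_pdivrMr // mulrC ler_wpM2l ?(ltW e0) // lerDl ler01.
have := maximum_re (bholoM (bholo_cst c) bg) vf z0d.
rewrite mulrC mulzJ creR => h; apply/eqP; rewrite -cabs_eq0 -sqrf_eq0.
by rewrite eq_le h sqr_ge0.
Qed.

End MaximumPrinciple.

(** * The Berezin transform of a composition operator *)

Section Berezin.
Variable R : realType.
Local Notation C := (Cplane R).
Local Notation leb2 := (@lebesgue_measure R \x @lebesgue_measure R)%E.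
Local Notation plane := (measurableTypeR R * measurableTypeR R)%type.
Local Notation D2 := (disk2 (R := R) : set plane).
Implicit Types (gamma : R) (f g h : C -> C) (z w xi : C).

Lemma tame_integrable_weight gamma (u : C -> R) M : -1 < gamma ->
  (forall z, disk z -> {for z, continuous u}) -> (forall z, disk z -> `|u z| <= M) ->
  leb2.-integrable D2 (EFin \o (fun q => u (pt q) * weight gamma (pt q))).
Proof.
move=> g1 cu uM; have p0 : 0 < gamma + 1 by lra.
have h := integrable_bounded_weight p0 cu uM.
apply: (eq_integrable measurable_disk2 _ _ _ (integrableZl measurable_disk2 (gamma + 1) h)).
by move=> q _ /=; rewrite /weight -EFinM addrK; congr EFin; rewrite mulrCA.
Qed.

Definition area : R := fine (leb2 D2).

Lemma fine_int_dAg gamma (u : C -> R) M : -1 < gamma ->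
  (forall z, disk z -> {for z, continuous u}) -> (forall z, disk z -> `|u z| <= M) ->
  fine (int_dAg gamma u) = (gamma + 1) / area *
    \int[leb2]_(q in D2) (u (pt q) * oneBsq (pt q) `^ gamma).
Proof.
move=> g1 cu uM; have p0 : 0 < gamma + 1 by lra.
have i1 := tame_integrable_weight g1 cu uM.
have h := integrable_bounded_weight p0 cu uM.
rewrite /int_dAg /int_dA fineM //; last exact: (integrable_fin_num measurable_disk2 i1).
rewrite [_ / area]mulrC -mulrA; congr (_ * _).
have {}h : leb2.-integrable D2 (EFin \o (fun q => u (pt q) * oneBsq (pt q) `^ gamma)).
  by apply: (eq_integrable measurable_disk2 _ _ _ h) => q _ /=; rewrite addrK.
rewrite -RintegralZl; [|exact: measurable_disk2|exact: h].
by apply: eq_Rintegral => q _; rewrite /weight mulrCA.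
Qed.

Lemma cint_dAgE gamma h : -1 < gamma -> tame h ->
  cint_dAg gamma h = creal ((gamma + 1) / area) * wint (gamma + 1) h.
Proof.
move=> g1 [ch [M hM]].
have cr z : disk z -> {for z, continuous (fun w => cre (h w))}.
  by move=> zd; exact: (continuous_comp (ch _ zd) (continuous_cre (z := _))).
have ci' z : disk z -> {for z, continuous (fun w => cim (h w))}.
  by move=> zd; exact: (continuous_comp (ch _ zd) (continuous_cim (z := _))).
have rM z : disk z -> `|cre (h z)| <= M.
  by move=> zd; exact: le_trans (ler_cre_cabs _) (hM _ zd).
have iM z : disk z -> `|cim (h z)| <= M.
  by move=> zd; exact: le_trans (ler_cim_cabs _) (hM _ zd).
apply: complexP.
  rewrite creM creR cimR mul0r subr0 wint_re addrK; exact: fine_int_dAg cr rM.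
rewrite cimM creR cimR mul0r addr0 wint_im addrK; exact: fine_int_dAg ci' iM.
Qed.

Lemma eq_cint_dAg gamma g h : (forall z, disk z -> g z = h z) ->
  cint_dAg gamma g = cint_dAg gamma h.
Proof.
move=> gh; congr (fine _ +i* fine _); congr (_ * _)%E; apply: eq_integral => q /set_mem qd;
  by rewrite gh.
Qed.

Lemma bholo_nkernel gamma xi : -1 < gamma -> disk xi -> bholo (nkernel gamma xi).
Proof.
move=> g1 x1; have a0 : 0 <= gamma + 2 by lra.
exact: bholoM (bholo_cst _) (bholo_bkernel a0 x1).
Qed.

(** Puts the normalized kernels in the Bergman space, where the action of [T] is prescribed. *)
Lemma bergman_bholo gamma f : -1 < gamma -> bholo f -> bergman gamma f.
Proof.
move=> g1 bf; split; first by move=> z zd; apply/derivable_rdiff; exact: bf.1.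
have [M fM] := bf.2; have [cf _] := bholo_tame bf.
have i1 : leb2.-integrable D2 (EFin \o (fun q => cabs (f (pt q)) ^+ 2 * weight gamma (pt q))).
  apply: (tame_integrable_weight (u := fun w => cabs (f w) ^+ 2) (M := M ^+ 2)) => // z zd.
    exact: (continuous_comp (cf _ zd) (continuous_cabs_sqr (z := _))).
  have M0 := le_trans (cabs_ge0 _) (fM _ zd).
  by rewrite ger0_norm ?sqr_ge0 // ler_pXn2r ?nnegrE ?cabs_ge0 ?fM.
have := integrable_fin_num measurable_disk2 i1 => fi.
rewrite /int_dAg /int_dA; set I := (X in (_ * X < _)%E).
have -> : I = (fine I)%:E by rewrite fineK.
by rewrite -EFinM ltry.
Qed.

(** The kernel composed with [psi] is bounded holomorphic, so it is reproduced at [xi]; the two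
    normalizing factors multiply to [s^(gamma+2)]. The constant in front is kept symbolic, as only
    its positivity enters. *)
Lemma berezinE gamma (psi : C -> C) T xi : -1 < gamma -> bholo psi ->
  (forall z, disk z -> disk (psi z)) -> is_composition_operator gamma psi T -> disk xi ->
  berezin gamma T xi = creal ((gamma + 1) / area * mass (gamma + 1) * oneBsq xi `^ (gamma + 2)) *
    bkernel xi (gamma + 2) (psi xi).
Proof.
move=> g1 bpsi psid HT x1; have p0 : 0 < gamma + 1 by lra.
have a0 : 0 <= gamma + 2 by lra.
have aE : gamma + 1 + 1 = gamma + 2 by ring.
have bn := bholo_nkernel g1 x1; have bk := bholo_bkernel a0 x1.
have bkp := bholo_comp bk bpsi psid.
set N := creal (oneBsq xi `^ ((gamma + 2) / 2)).
pose H w := N ^+ 2 * (bkernel xi (gamma + 2) (psi w) * cconj (bkernel xi (gamma + 2) w)).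
have t1 : tame (fun w => bkernel xi (gamma + 2) (psi w) * cconj (bkernel xi (gamma + 2) w)).
  exact: tameM (bholo_tame bkp) (tameJ (bholo_tame bk)).
have tH : tame H by exact: tameM (tame_cst _) t1.
have -> : berezin gamma T xi = cint_dAg gamma H.
  apply: eq_cint_dAg => w wd; rewrite (HT _ (bergman_bholo g1 bn) _ wd).
  rewrite -[LHS]/(N * bkernel xi (gamma + 2) (psi w) * cconj (N * bkernel xi (gamma + 2) w)).
  by rewrite cconjM cconjR -/N /H; ring.
rewrite cint_dAgE // wintZ //.
have := reproducing p0 bkp x1; rewrite aE => ->.
have -> : N ^+ 2 = creal (oneBsq xi `^ (gamma + 2)).
  rewrite expr2 -crealM -powRD; first by congr (creal (_ `^ _)); field.
  by apply/implyP => _; rewrite gt_eqF // oneBsq_gt0.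
by rewrite !crealM; ring.
Qed.

End Berezin.

(** * Boundary behaviour of [psi] and conclusion *)

Lemma vanishing_sub_id (R : realType) (psi : Cplane R -> Cplane R) (k : R) : 0 <= k ->
  (forall z, disk z -> disk (psi z)) ->
  (forall z, disk z -> cabs (1 - cconj z * psi z) <= k * oneBsq z) ->
  vanishes_at_boundary (fun z => psi z + - 1 * z).
Proof.
move=> k0 psid H e e0; have k1 : 0 < 2 * (k + 1) by lra.
(* The estimate is [|psi(z) - z| <= (k + 1) s <= 2 (k + 1) (1 - |z|)]. *)
exists (1 - e / (2 * (k + 1))); first by rewrite gtrBl divr_gt0.
move=> z zd rz.
have -> : psi z + - 1 * z = creal (oneBsq z) * psi z - z * (1 - cconj z * psi z).
  by rewrite oneBsqE; ring.
have s0 : 0 < oneBsq z by rewrite oneBsq_gt0.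
apply: le_trans (cabsD _ _) _; rewrite cabsN !cabsM cabsR gtr0_norm //.
have h1 : oneBsq z * cabs (psi z) <= oneBsq z.
  by rewrite ler_piMr ?(ltW s0) //; exact: ltW (psid _ zd).
have h2 : cabs z * cabs (1 - cconj z * psi z) <= k * oneBsq z.
  by apply: le_trans (ler_piMl (cabs_ge0 _) (ltW zd)) (H _ zd).
have h3 : oneBsq z <= 2 * (1 - cabs z).
  have : 0 <= (1 - cabs z) ^+ 2 by rewrite sqr_ge0.
  by rewrite /oneBsq sqrrB expr1n mul1r mulr2n; lra.
have h4 : (1 - cabs z) * (2 * (k + 1)) <= e by rewrite -ler_pdivlMr //; lra.
have h5 : (k + 1) * oneBsq z <= (k + 1) * (2 * (1 - cabs z)) by rewrite ler_wpM2l // addr_ge0.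
lra.
Qed.

Theorem proposition4p9 (R : realType) (gamma : R) (psi : Cplane R -> Cplane R)
    (T : (Cplane R -> Cplane R) -> (Cplane R -> Cplane R)) :
  -1 < gamma ->
  holomorphic_on_disk psi ->
  (forall z, disk z -> disk (psi z)) ->
  ~ (forall z, disk z -> psi z = z) ->
  is_composition_operator gamma psi T ->
  (closure (Ber gamma T) `\` Ber gamma T) 0.
Proof.
move=> g1 hpsi psid nid HT.
have p0 : 0 < gamma + 1 by lra.
have a0 : 0 < gamma + 2 by lra.
have bpsi : bholo psi.
  split; first by move=> z /hpsi/derivable_rdiff.
  by exists 1 => z /psid/ltW.
pose c := (gamma + 1) / area R * mass (gamma + 1).
have c0 : 0 < c by rewrite /c mulr_gt0 ?mass_gt0 // divr_gt0 // disk2_gt0.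
have BE xi : disk xi -> berezin gamma T xi =
    creal (c * oneBsq xi `^ (gamma + 2)) * bkernel xi (gamma + 2) (psi xi).
  by move=> xd; rewrite (berezinE g1 bpsi psid HT xd).
clearbody c.
split; last first.
  move=> [xi xd]; rewrite BE // => /eqP; rewrite mulf_eq0 creal_eq0.
  rewrite (negbTE (bkernel_neq0 _ xd (psid _ xd))) orbF mulf_eq0 gt_eqF //= powR_eq0.
  by rewrite gt_eqF // oneBsq_gt0.
(* If some ball of radius [e] around 0 missed the range, the Berezin transform would have modulus at
   least [e] everywhere; this forces [psi] to be the identity. *)
move=> U /nbhs_cabs[e e0 HU]; apply: contrapT => none; apply: nid => z zd.
have large xi : disk xi -> e <= cabs (berezin gamma T xi).
  move=> xd; rewrite leNgt; apply/negP => h; apply: none.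
  exists (berezin gamma T xi); split; first by exists xi.
  by apply: HU; rewrite subr0.
have ec0 : 0 < e / c by rewrite divr_gt0.
(* Obtained by solving [c (s / |1 - conj(xi) psi(xi)|)^(gamma+2) >= e] for the denominator. *)
pose k := (e / c) `^ (- (gamma + 2)^-1).
have k0 : 0 < k by rewrite powR_gt0.
have psi_near xi : disk xi -> cabs (1 - cconj xi * psi xi) <= k * oneBsq xi.
  move=> xd; have s0 : 0 < oneBsq xi by rewrite oneBsq_gt0.
  have n0 : 0 < cabs (1 - cconj xi * psi xi) by rewrite cabs_gt0 oneBJM_neq0 //; exact: psid.
  have := large _ xd; rewrite BE // cabsM cabsR cabs_bkernel //; last exact: psid.
  rewrite ger0_norm ?mulr_ge0 ?powR_ge0 ?(ltW c0) //.
  rewrite ler_pdivlMr ?powR_gt0 // => h0.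
  have h : cabs (1 - cconj xi * psi xi) `^ (gamma + 2) * (e / c) <= oneBsq xi `^ (gamma + 2).
    by rewrite mulrA ler_pdivrMr // [_ * e]mulrC [leRHS]mulrC.
  have aN : gamma + 2 != 0 by rewrite gt_eqF.
  have root (x : R) : 0 < x -> (x `^ (gamma + 2)) `^ (gamma + 2)^-1 = x.
    by move=> x0; rewrite -powRrM divff // powRr1 // ltW.
  have ia0 : 0 <= (gamma + 2)^-1 by rewrite invr_ge0 ltW.
  have hx : cabs (1 - cconj xi * psi xi) `^ (gamma + 2) * (e / c) \in Num.nneg.
    by rewrite nnegrE mulr_ge0 ?powR_ge0 // ltW.
  have hy : oneBsq xi `^ (gamma + 2) \in Num.nneg by rewrite nnegrE powR_ge0.
  have := ge0_ler_powR ia0 hx hy h.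
  rewrite powRM ?powR_ge0 ?(ltW ec0) // !root // mulrC.
  by rewrite /k powRN ler_pdivlMl ?powR_gt0.
have bg : bholo (fun w => psi w + - 1 * w).
  apply: bholoD bpsi (bholoM (bholo_cst _) _); split.
    by move=> w _; exists 1; exact: rdiff_id.
  by exists 1 => w /ltW.
have := vanishing_bholo bg (vanishing_sub_id (ltW k0) psid psi_near) zd.
by rewrite mulN1r => /eqP; rewrite subr_eq0 => /eqP.
Qed.
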